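(* Let $n\in\mathbb Z_{\ge 0}$, let $\alpha=(\alpha_i\in F\mid -\infty<i\le n-2)$ be a sequence with corresponding series $\alpha(x)$, and for an $(n,s)$-type series $r=\sum_{k\ge0}\sum_{i=1}^d f_{k,i}\otimes b_iy^k\in(L(n,\alpha)\otimes\mathfrak g)[\![y]\!]$ put $W(r)=\mathrm{span}_F\{f_{k,i}\mid k\ge0,\ 1\le i\le d\}\subseteq L(n,\alpha)$. Then: 1. $W$ defines a bijection between skew-symmetric $\left(n,\frac{1}{x^n\alpha(x)}\right)$-type series and Lagrangian subspaces $V\subseteq L(n,\alpha)$ complementary to the diagonal $\Delta$. 2. $W$ defines a bijection between $\left(n,\frac{1}{x^n\alpha(x)}\right)$-type series $r$ solving the generalized classical Yang–Baxter equation $\mathrm{GCYB}(r)=0$ and Lie subalgebras $V\subseteq L(n,\alpha)$ complementary to the diagonal $\Delta$.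
   Context: $F$ is an algebraically closed field of characteristic $0$, $\mathfrak g$ a finite-dimensional simple Lie algebra over $F$ with Killing form $\kappa$, $\{b_i\}_{i=1}^d$ a basis of $\mathfrak g$ orthonormal for $\kappa$, $\Omega=\sum_i b_i\otimes b_i$. **The algebra $L(n,\alpha)$.** For $n\ge0$ and $\alpha=(\alpha_i)_{i\le n-2}$ let $\alpha(x)=x^{-n}+\alpha_{n-2}x^{-n+1}+\dots+\alpha_0x^{-1}+\dots\in F(\!(x)\!)$ (the coefficient of $x^{-i-1}$ is $\alpha_i$; for $n=0$, $\alpha(x)=1+\alpha_{-2}x+\dots$). So $x^n\alpha(x)\in F[\![x]\!]^\times$. Let $A(n,\alpha)=F(\!(x)\!)\times F[x]/(x^n)$ (second factor zero if $n=0$), $L(n,\alpha)=\mathfrak g\otimes A(n,\alpha)=\mathfrak g(\!(x)\!)\times\mathfrak g[x]/x^n\mathfrak g[x]$ with the bracket $[a\otimes f,b\otimes g]=[a,b]\otimes fg$. Let $t(f,[p])=\mathrm{res}_0\{\alpha(x)(f-p)\}$ and $B(a\otimes u,b\otimes v)=\kappa(a,b)\,t(uv)$, a symmetric non-degenerate invariant form. For $b\in\mathfrak g$ write $b(f,[p])$ for $b\otimes(f,[p])$. The diagonal is $\Delta=\{(f,[f])\mid f\in\mathfrak g[\![x]\!]\}\cong\mathfrak g[\![x]\!]$. ''Complementary to $\Delta$'' means $L(n,\alpha)=\Delta\oplus V$ as vector spaces; Lagrangian means $V=V^\perp$ with respect to $B$. $F[\![x]\!]$ acts on $L(n,\alpha)$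 by $s\cdot(f,[p])=(sf,[sp])$. **Series of type $(n,s)$.** Elements of $(L(n,\alpha)\otimes\mathfrak g)[\![y]\!]$ are written $\sum_{k\ge0}\sum_i f_{k,i}\otimes b_iy^k$ with $f_{k,i}\in L(n,\alpha)$, where $y^k$ stands for $(y^k,[y]^k)$. One interprets $$\frac{y^n\Omega}{x-y}:=\sum_{k\ge0}\sum_{i=1}^d w_{k,i}\otimes b_iy^k,\qquad w_{k,i}=\begin{cases}b_i(0,-[x]^{n-1-k}),&0\le k\le n-1,\\ b_i(x^{n-1-k},0),&k\ge n.\end{cases}$$ $(\mathfrak g\otimes\mathfrak g)[\![x,y]\!]$ is viewed inside $(L(n,\alpha)\otimes\mathfrak g)[\![y]\!]$ via $\mathfrak g[\![x]\!]\cong\Delta$. For $s\in F[\![x]\!]^\times$, a series of type $(n,s)$ is $r=\frac{s(x)y^n\Omega}{x-y}+g(x,y)$ with $g\in(\mathfrak g\otimes\mathfrak g)[\![x,y]\!]$. Put $\overline r:=\frac{s(y)x^n\Omega}{x-y}-\tau(g(y,x))$, where $\tau$ is the $F[\![x,y]\!]$-linear extension of $a\otimes b\mapsto b\otimes a$; this is the $(n,s)$-type series $\frac{s(x)y^n\Omega}{x-y}-\frac{s(x)y^n-s(y)x^n}{x-y}\Omega-\tau(g(y,x))$, where $\frac{s(x)y^n-s(y)x^n}{x-y}\in F[\![x,y]\!]$. The series $r$ is skew-symmetric if $r=\overline r$. **GCYB.** Let $A_1=A(n,\alpha)$ in the variable $x_1$ and $A_m=A_{m-1}(\!(x_m)\!)\oplus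 A_{m-1}[x_m]/x_m^nA_{m-1}$. For $r=\sum f_{k,i}\otimes b_iy^k$ define in the associative algebra $U(\mathfrak g)^{\otimes3}\otimes A_3$: $r^{12}=\sum f_{k,i}(x_1)\otimes b_ix_2^k\otimes1$, $r^{13}=\sum f_{k,i}(x_1)\otimes1\otimes b_ix_3^k$, $r^{23}=\sum1\otimes f_{k,i}(x_2)\otimes b_ix_3^k$ (with $x_j^k$ standing for $(x_j^k,[x_j]^k)$), similarly for $\overline r$, and $$\mathrm{GCYB}(r)=[r^{12},r^{13}]+[r^{12},r^{23}]+[r^{13},\overline r^{23}].$$ *)

(* Defs.v *)
From HB Require Import structures.
From mathcomp Require Import all_boot all_order all_algebra.
From mathcomp Require Import boolp classical_sets functions cardinality fsbigop.
From mathcomp Require Import zify.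

Set Implicit Arguments.
Unset Strict Implicit.
Unset Printing Implicit Defensive.

Import Order.TTheory GRing.Theory Num.Theory.

Local Open Scope classical_set_scope.
Local Open Scope ring_scope.

(* An F-algebra is a ring with a homomorphism from F to its center.  [algType]
   of the library excludes the zero ring, but F[x]/(x^n) is zero for n = 0. *)
HB.mixin Record PzRing_isPzAlgebra (F : fieldType) A of GRing.PzRing A := {
  ascal : F -> A;
  ascalD : forall a c, ascal (a + c) = ascal a + ascal c;
  ascalM : forall a c, ascal (a * c) = ascal a * ascal c;
  ascal1 : ascal 1 = 1;
  ascalC : forall a x, ascal a * x = x * ascal a }.

#[short(type="pzAlgType")]
HB.structure Definition PzAlgebra (F : fieldType) :=
  {A of GRing.PzRing A & PzRing_isPzAlgebra F A}.

Lemma ascal0 (F : fieldType) (A : pzAlgType F) : ascal 0 = 0 :> A.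
Proof. by apply: (@addrI _ (ascal 0)); rewrite -ascalD !addr0. Qed.

HB.instance Definition _ (F : fieldType) :=
  @PzRing_isPzAlgebra.Build F F id
    (fun _ _ => erefl) (fun _ _ => erefl) erefl (fun a x => mulrC a x).

Section PairAlgebra.
Context (F : fieldType) (A B : pzAlgType F).
Let sc (a : F) : (A * B)%type := (ascal a, ascal a).
Fact pair_ascalD a c : sc (a + c) = sc a + sc c.
Proof. by congr pair; rewrite ascalD. Qed.
Fact pair_ascalM a c : sc (a * c) = sc a * sc c.
Proof. by congr pair; rewrite ascalM. Qed.
Fact pair_ascal1 : sc 1 = 1.
Proof. by congr pair; rewrite ascal1. Qed.
Fact pair_ascalC a x : sc a * x = x * sc a.
Proof. by case: x => x y; congr pair; rewrite /= ascalC. Qed.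
HB.instance Definition _ := PzRing_isPzAlgebra.Build F (A * B)%type
  pair_ascalD pair_ascalM pair_ascal1 pair_ascalC.
End PairAlgebra.

Definition commutator (A : pzRingType) (x y : A) : A := x * y - y * x.

(* The unital associative F-algebra on generators X and relations rel, as the
   quotient of the set of formal expressions by the least congruence [teq]
   containing rel and the axioms of F-algebras. *)
Section Presentation.
Context (F : fieldType) (X : Type).

Inductive term :=
  | Tgen of X | Tconst of F
  | Tadd of term & term | Topp of term | Tmul of term & term.

Context (rel : term -> term -> Prop).

Inductive teq : term -> term -> Prop :=
  | teq_rel x y of rel x y : teq x y
  | teq_refl x : teq x x
  | teq_sym x y of teq x y : teq y x
  | teq_trans x y z of teq x y & teq y z : teq x z
  | teq_add x x' y y' of teq x x' & teq y y' : teq (Tadd x y) (Tadd x' y')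
  | teq_opp x x' of teq x x' : teq (Topp x) (Topp x')
  | teq_mul x x' y y' of teq x x' & teq y y' : teq (Tmul x y) (Tmul x' y')
  | teq_addA x y z : teq (Tadd x (Tadd y z)) (Tadd (Tadd x y) z)
  | teq_addC x y : teq (Tadd x y) (Tadd y x)
  | teq_add0 x : teq (Tadd (Tconst 0) x) x
  | teq_addN x : teq (Tadd (Topp x) x) (Tconst 0)
  | teq_mulA x y z : teq (Tmul x (Tmul y z)) (Tmul (Tmul x y) z)
  | teq_mul1 x : teq (Tmul (Tconst 1) x) x
  | teq_mulr1 x : teq (Tmul x (Tconst 1)) x
  | teq_mulDl x y z : teq (Tmul (Tadd x y) z) (Tadd (Tmul x z) (Tmul y z))
  | teq_mulDr x y z : teq (Tmul x (Tadd y z)) (Tadd (Tmul x y) (Tmul x z))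
  | teq_constD a c : teq (Tconst (a + c)) (Tadd (Tconst a) (Tconst c))
  | teq_constM a c : teq (Tconst (a * c)) (Tmul (Tconst a) (Tconst c))
  | teq_constC a x : teq (Tmul (Tconst a) x) (Tmul x (Tconst a)).

Record presented := Presented {
  pclass : set term; pclassP : exists t, pclass = teq t }.

Definition tcl (t : term) : presented :=
  Presented (ex_intro (fun u => teq t = teq u) t erefl).

Definition repr (p : presented) : term := projT1 (cid (pclassP p)).

Lemma pclass_inj p q : pclass p = pclass q -> p = q.
Proof.
by case: p q => [c hc] [c' hc'] /= e; subst c'; congr Presented; apply: Prop_irrelevance.
Qed.

Lemma reprK p : tcl (repr p) = p.
Proof.
by apply: pclass_inj; rewrite /repr; case: (cid _).
Qed.

Lemma tcl_eq t u : teq t u -> tcl t = tcl u.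
Proof.
move=> tu; apply: pclass_inj; apply/funext => v; apply/propext.
by split=> h; [apply: teq_trans h; apply: teq_sym|apply: teq_trans h].
Qed.

Lemma tcl_inj t u : tcl t = tcl u -> teq t u.
Proof.
by move/(congr1 pclass) => /= e; rewrite e; apply: teq_refl.
Qed.

Lemma repr_tcl t : teq (repr (tcl t)) t.
Proof. by apply: tcl_inj; rewrite reprK. Qed.

HB.instance Definition _ := gen_eqMixin presented.
HB.instance Definition _ := gen_choiceMixin presented.

Definition padd p q := tcl (Tadd (repr p) (repr q)).
Definition popp p := tcl (Topp (repr p)).
Definition pmul p q := tcl (Tmul (repr p) (repr q)).

Lemma padd_tcl t u : padd (tcl t) (tcl u) = tcl (Tadd t u).
Proof. by apply: tcl_eq; apply: teq_add; apply: repr_tcl. Qed.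
Lemma popp_tcl t : popp (tcl t) = tcl (Topp t).
Proof. by apply: tcl_eq; apply: teq_opp; apply: repr_tcl. Qed.
Lemma pmul_tcl t u : pmul (tcl t) (tcl u) = tcl (Tmul t u).
Proof. by apply: tcl_eq; apply: teq_mul; apply: repr_tcl. Qed.

Lemma tclP p : exists t, p = tcl t. Proof. by exists (repr p); rewrite reprK. Qed.

Let tclE := (padd_tcl, popp_tcl, pmul_tcl).

Fact paddA : associative padd.
Proof.
move=> p q r; have [x ->] := tclP p; have [y ->] := tclP q; have [z ->] := tclP r.
by rewrite !tclE; apply/tcl_eq/teq_addA.
Qed.
Fact paddC : commutative padd.
Proof.
move=> p q; have [x ->] := tclP p; have [y ->] := tclP q.
by rewrite !tclE; apply/tcl_eq/teq_addC.
Qed.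
Fact padd0 : left_id (tcl (Tconst 0)) padd.
Proof. by move=> p; have [x ->] := tclP p; rewrite !tclE; apply/tcl_eq/teq_add0. Qed.
Fact paddN : left_inverse (tcl (Tconst 0)) popp padd.
Proof. by move=> p; have [x ->] := tclP p; rewrite !tclE; apply/tcl_eq/teq_addN. Qed.

HB.instance Definition _ :=
  GRing.isZmodule.Build presented paddA paddC padd0 paddN.

Fact pmulA : associative pmul.
Proof.
move=> p q r; have [x ->] := tclP p; have [y ->] := tclP q; have [z ->] := tclP r.
by rewrite !tclE; apply/tcl_eq/teq_mulA.
Qed.
Fact pmul1 : left_id (tcl (Tconst 1)) pmul.
Proof. by move=> p; have [x ->] := tclP p; rewrite !tclE; apply/tcl_eq/teq_mul1. Qed.
Fact pmulr1 : right_id (tcl (Tconst 1)) pmul.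
Proof. by move=> p; have [x ->] := tclP p; rewrite !tclE; apply/tcl_eq/teq_mulr1. Qed.
Fact pmulDl : left_distributive pmul +%R.
Proof.
move=> p q r; have [x ->] := tclP p; have [y ->] := tclP q; have [z ->] := tclP r.
by rewrite /GRing.add /= !tclE; apply/tcl_eq/teq_mulDl.
Qed.
Fact pmulDr : right_distributive pmul +%R.
Proof.
move=> p q r; have [x ->] := tclP p; have [y ->] := tclP q; have [z ->] := tclP r.
by rewrite /GRing.add /= !tclE; apply/tcl_eq/teq_mulDr.
Qed.

HB.instance Definition _ := GRing.Zmodule_isPzRing.Build presented
  pmulA pmul1 pmulr1 pmulDl pmulDr.

Let pconst (a : F) : presented := tcl (Tconst a).

Fact pconstD a c : pconst (a + c) = pconst a + pconst c.
Proof. by rewrite /GRing.add /= !tclE; apply/tcl_eq/teq_constD. Qed.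
Fact pconstM a c : pconst (a * c) = pconst a * pconst c.
Proof. by rewrite /GRing.mul /= !tclE; apply/tcl_eq/teq_constM. Qed.
Fact pconstC a p : pconst a * p = p * pconst a.
Proof.
by have [x ->] := tclP p; rewrite /GRing.mul /= !tclE; apply/tcl_eq/teq_constC.
Qed.

HB.instance Definition _ := PzRing_isPzAlgebra.Build F presented
  pconstD pconstM erefl pconstC.

Fixpoint teval (A : pzAlgType F) (h : X -> A) (t : term) : A :=
  match t with
  | Tgen x => h x | Tconst a => ascal a
  | Tadd x y => teval h x + teval h y
  | Topp x => - teval h x
  | Tmul x y => teval h x * teval h y
  end.

Definition presented_lift (A : pzAlgType F) (h : X -> A) (p : presented) : A :=
  teval h (repr p).

Section Lift.
Context (A : pzAlgType F) (h : X -> A).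
Hypothesis hrel : forall t u, rel t u -> teval h t = teval h u.

Lemma teval_teq t u : teq t u -> teval h t = teval h u.
Proof.
elim=> //=; [by move=> ? ? ? _ -> _ ->|..].
- by move=> ? ? ? ? _ -> _ ->.
- by move=> ? ? _ ->.
- by move=> ? ? ? ? _ -> _ ->.
- by move=> ? ? ?; rewrite addrA.
- by move=> ? ?; rewrite addrC.
- by move=> ?; rewrite ascal0 add0r.
- by move=> ?; rewrite ascal0 addNr.
- by move=> ? ? ?; rewrite mulrA.
- by move=> ?; rewrite ascal1 mul1r.
- by move=> ?; rewrite ascal1 mulr1.
- by move=> ? ? ?; rewrite mulrDl.
- by move=> ? ? ?; rewrite mulrDr.
- by move=> ? ?; rewrite ascalD.
- by move=> ? ?; rewrite ascalM.
- by move=> ? ?; rewrite ascalC.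
Qed.

Lemma presented_lift_tcl t : presented_lift h (tcl t) = teval h t.
Proof. apply: teval_teq; exact: repr_tcl. Qed.

Lemma presented_liftP :
  [/\ forall x, presented_lift h (tcl (Tgen x)) = h x,
      forall a, presented_lift h (ascal a) = ascal a,
      forall p q, presented_lift h (p + q) = presented_lift h p + presented_lift h q
    & forall p q, presented_lift h (p * q) = presented_lift h p * presented_lift h q].
Proof. by split=> [x|a|p q|p q]; exact: presented_lift_tcl. Qed.
End Lift.

End Presentation.

HB.mixin Record Vector_isLie (F : fieldType) (g : Type) of Vector F g := {
  lie : g -> g -> g;
  liePl : forall a x y z, lie (a *: x + y) z = a *: lie x z + lie y z;
  liePr : forall a x y z, lie z (a *: x + y) = a *: lie z x + lie z y;
  liexx : forall x, lie x x = 0;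
  lie_jacobi : forall x y z, lie x (lie y z) + lie y (lie z x) + lie z (lie x y) = 0 }.

#[short(type="lieAlgType")]
HB.structure Definition LieAlgebra (F : fieldType) :=
  {g of Vector F g & Vector_isLie F g}.

Section Lie.
Context (F : fieldType) (g : lieAlgType F).
Implicit Types x y : g.

Definition simple_lie : Prop :=
  (exists x y, lie x y != 0) /\
  forall I : {vspace g}, (forall x y, y \in I -> lie x y \in I) ->
    I = 0%VS \/ I = fullv.

(* The trace of (ad x) o (ad y). *)
Definition killing x y : F :=
  \sum_(i < \dim {:g}) coord (vbasis {:g}) i (lie x (lie y (vbasis {:g})`_i)).

Lemma lie0x x : lie 0 x = 0.
Proof. by have := liePl 1 (0 : g) 0 x; rewrite scaler0 addr0 scale1r => /esym/(canRL (addrK _)) ->; rewrite subrr. Qed.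

Lemma liex0 x : lie x 0 = 0.
Proof. by have := liePr 1 (0 : g) 0 x; rewrite scaler0 addr0 scale1r => /esym/(canRL (addrK _)) ->; rewrite subrr. Qed.

Lemma killing0x x : killing 0 x = 0.
Proof. by rewrite /killing big1 // => i _; rewrite lie0x linear0. Qed.

Lemma killingx0 x : killing x 0 = 0.
Proof. by rewrite /killing big1 // => i _; rewrite lie0x liex0 linear0. Qed.

Definition orthonormal_basis d (b : d.-tuple g) : Prop :=
  basis_of {:g} b /\ forall i j : 'I_d, killing b`_i b`_j = (i == j)%:R.

Inductive env_rel : term F g -> term F g -> Prop :=
  | env_lin a x y :
      env_rel (Tgen F (a *: x + y)) (Tadd (Tmul (Tconst g a) (Tgen F x)) (Tgen F y))
  | env_lie x y :
      env_rel (Tgen F (lie x y))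
        (Tadd (Tmul (Tgen F x) (Tgen F y)) (Topp (Tmul (Tgen F y) (Tgen F x)))).

(* U(g), the quotient of the tensor algebra of g by x y - y x = [x, y]. *)
Definition env : pzAlgType F := presented env_rel.

Definition envi (x : g) : env := tcl env_rel (Tgen F x).

End Lie.

Section Tensor.
Context (F : fieldType) (A B : pzAlgType F).

Let l (x : A) : term F (A + B) := Tgen F (inl x).
Let r (y : B) : term F (A + B) := Tgen F (inr y).

(* The tensor product over F as the universal algebra with commuting
   homomorphisms from A and from B. *)
Inductive tens_rel : term F (A + B) -> term F (A + B) -> Prop :=
  | tensl_add x y : tens_rel (l (x + y)) (Tadd (l x) (l y))
  | tensl_mul x y : tens_rel (l (x * y)) (Tmul (l x) (l y))
  | tensl_scal a : tens_rel (l (ascal a)) (Tconst _ a)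
  | tensr_add x y : tens_rel (r (x + y)) (Tadd (r x) (r y))
  | tensr_mul x y : tens_rel (r (x * y)) (Tmul (r x) (r y))
  | tensr_scal a : tens_rel (r (ascal a)) (Tconst _ a)
  | tens_comm x y : tens_rel (Tmul (l x) (r y)) (Tmul (r y) (l x)).

Definition tens : pzAlgType F := presented tens_rel.

Definition tensor (x : A) (y : B) : tens := tcl tens_rel (l x) * tcl tens_rel (r y).

End Tensor.

Definition lbounded (V : zmodType) (f : int -> V) : Prop :=
  exists N : int, forall k, k < N -> f k = 0.

(* V((x)) *)
Record laurent (V : zmodType) := Laurent {
  lcoef :> int -> V; lcoef_bounded : lbounded lcoef }.

Lemma laurentP (V : zmodType) (f h : laurent V) : (forall k, f k = h k) -> f = h.
Proof.
case: f h => [f hf] [h hh] /= /funext e; subst h.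
by congr Laurent; apply: Prop_irrelevance.
Qed.

Section LaurentModule.
Context (V : zmodType).
Implicit Types f h : laurent V.

HB.instance Definition _ := gen_eqMixin (laurent V).
HB.instance Definition _ := gen_choiceMixin (laurent V).

Fact lzero_bounded : lbounded (fun _ => 0 : V). Proof. by exists 0. Qed.
Fact lopp_bounded f : lbounded (fun k => - f k).
Proof. by have [N fN] := lcoef_bounded f; exists N => k /fN ->; rewrite oppr0. Qed.
Fact ladd_bounded f h : lbounded (fun k => f k + h k).
Proof.
have [N fN] := lcoef_bounded f; have [M hM] := lcoef_bounded h.
exists (Num.min N M) => k; rewrite lt_min => /andP[/fN -> /hM ->].
by rewrite addr0.
Qed.

Let zero := Laurent lzero_bounded.
Let opp f := Laurent (lopp_bounded f).
Let add f h := Laurent (ladd_bounded f h).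

Fact laddA : associative add.
Proof. by move=> f h u; apply: laurentP => k /=; rewrite addrA. Qed.
Fact laddC : commutative add.
Proof. by move=> f h; apply: laurentP => k /=; rewrite addrC. Qed.
Fact ladd0 : left_id zero add.
Proof. by move=> f; apply: laurentP => k /=; rewrite add0r. Qed.
Fact laddN : left_inverse zero opp add.
Proof. by move=> f; apply: laurentP => k /=; rewrite addNr. Qed.

HB.instance Definition _ := GRing.isZmodule.Build (laurent V) laddA laddC ladd0 laddN.

Lemma lcoefD f h k : (f + h) k = f k + h k. Proof. by []. Qed.
Lemma lcoefN f k : (- f) k = - f k. Proof. by []. Qed.
Lemma lcoef0 k : (0 : laurent V) k = 0. Proof. by []. Qed.

Fact lser_bounded (c : nat -> V) : lbounded (fun k => if k is Posz m then c m else 0).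
Proof. by exists 0; case. Qed.

(* A power series in V[[x]], as a Laurent series. *)
Definition lser (c : nat -> V) : laurent V := Laurent (lser_bounded c).

Fact lmono_bounded (m : int) (v : V) : lbounded (fun k => if k == m then v else 0).
Proof. by exists m => k; case: eqP => // ->; rewrite ltxx. Qed.

(* v x^m *)
Definition lmono m v : laurent V := Laurent (lmono_bounded m v).

End LaurentModule.

Section LaurentLmodule.
Context (F : fieldType) (V : lmodType F).

Fact lscale_bounded (a : F) (f : laurent V) : lbounded (fun k => a *: f k).
Proof. by have [N fN] := lcoef_bounded f; exists N => k /fN ->; rewrite scaler0. Qed.

Let scale a f := Laurent (lscale_bounded a f).

Fact lscaleA a c f : scale a (scale c f) = scale (a * c) f.
Proof. by apply: laurentP => k /=; rewrite scalerA. Qed.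
Fact lscale1 : left_id 1 scale.
Proof. by move=> f; apply: laurentP => k /=; rewrite scale1r. Qed.
Fact lscaleDr : right_distributive scale +%R.
Proof. by move=> a f h; apply: laurentP => k /=; rewrite scalerDr. Qed.
Fact lscaleDl f : {morph scale^~ f : a c / a + c}.
Proof. by move=> a c; apply: laurentP => k /=; rewrite scalerDl. Qed.

HB.instance Definition _ := GRing.Zmodule_isLmodule.Build F (laurent V)
  lscaleA lscale1 lscaleDr lscaleDl.

Lemma lcoefZ a (f : laurent V) k : (a *: f) k = a *: f k. Proof. by []. Qed.

End LaurentLmodule.

Section LaurentMap.
Context (V W : zmodType) (phi : V -> W) (phi0 : phi 0 = 0).

Fact lmap_bounded (f : laurent V) : lbounded (fun k => phi (f k)).
Proof. by have [N fN] := lcoef_bounded f; exists N => k /fN ->. Qed.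

Definition lmap (f : laurent V) : laurent W := Laurent (lmap_bounded f).
End LaurentMap.

(* The x-bilinear extension of a biadditive operation U x V -> W to
   U((x)) x V((x)) -> W((x)); the sum has finite support. *)
Section LaurentConvolution.
Context (U V W : zmodType) (op : U -> V -> W).
Hypotheses (op0l : forall v, op 0 v = 0) (op0r : forall u, op u 0 = 0).

Definition lconv_coef (f : laurent U) (h : laurent V) (k : int) : W :=
  \sum_(i \in [set: int]) op (f i) (h (k - i)).

Lemma lconv_coefE (f : laurent U) (h : laurent V) (a c k : int) (N : nat) :
  (forall i, i < a -> f i = 0) -> (forall i, i < c -> h i = 0) ->
  k < a + c + N%:Z ->
  lconv_coef f h k = \sum_(i < N) op (f (a + i%:Z)) (h (k - a - i%:Z)).
Proof.
move=> fa hc kN; pose r := [seq a + i%:Z | i <- iota 0 N].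
have ur : uniq r.
  by rewrite map_inj_uniq ?iota_uniq // => i j /addrI[].
have -> : \sum_(i < N) op (f (a + i%:Z)) (h (k - a - i%:Z)) =
    \sum_(j <- r) op (f j) (h (k - j)).
  rewrite /r; have -> : iota 0 N = index_iota 0 N by rewrite /index_iota subn0.
  rewrite big_map big_mkord.
  by apply: eq_bigr => i _; rewrite opprD addrA.
rewrite [RHS]fsbig_seq //; apply/esym/fsbig_widen => // i [_ /= /negP ir].
have [/fa ->|ai] := ltP i a; first by rewrite op0l.
rewrite hc ?op0r // ltNge; apply: contra ir => ci.
apply/mapP; exists (absz (i - a)%R); last by lia.
rewrite mem_iota /=; lia.
Qed.

Fact lconv_bounded f h : lbounded (lconv_coef f h).
Proof.
have [a fa] := lcoef_bounded f; have [c hc] := lcoef_bounded h.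
exists (a + c) => k kac; rewrite (@lconv_coefE f h a c k 0) ?big_ord0 //.
by rewrite addr0.
Qed.

Definition lconv (f : laurent U) (h : laurent V) : laurent W :=
  Laurent (lconv_bounded f h).

End LaurentConvolution.

Section LaurentRing.
Context (R : pzRingType).
Implicit Types f h u : laurent R.

Definition lmul : laurent R -> laurent R -> laurent R := lconv (@mul0r R) (@mulr0 R).

Lemma lmulE f h (a c k : int) (N : nat) :
  (forall i, i < a -> f i = 0) -> (forall i, i < c -> h i = 0) ->
  k < a + c + N%:Z ->
  lmul f h k = \sum_(i < N) f (a + i%:Z) * h (k - a - i%:Z).
Proof. exact: lconv_coefE (@mul0r R) (@mulr0 R) _ _ _ _ _ _. Qed.

Fact lmulA : associative lmul.
Proof.
move=> f h u; have [a fa] := lcoef_bounded f.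
have [b hb] := lcoef_bounded h; have [c uc] := lcoef_bounded u.
have fh0 i : i < a + b -> lmul f h i = 0.
  by move=> iab; rewrite (@lmulE _ _ a b _ 0) ?big_ord0 ?addr0.
have hu0 i : i < b + c -> lmul h u i = 0.
  by move=> ibc; rewrite (@lmulE _ _ b c _ 0) ?big_ord0 ?addr0.
apply: laurentP => k; pose N := ((absz (k - a - b - c)%R).+1).
rewrite (@lmulE f _ a (b + c) k N) //; last by rewrite /N; lia.
rewrite (@lmulE _ u (a + b) c k N) //; last by rewrite /N; lia.
transitivity (\sum_(i < N) \sum_(j < N)
    f (a + j%:Z) * h (b - j%:Z + i%:Z) * u (k - (a + b) - i%:Z)).
  rewrite exchange_big; apply: eq_bigr => j _.
  rewrite (@lmulE h u (b - j%:Z) c (k - a - j%:Z) N) //.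
  - rewrite mulr_sumr; apply: eq_bigr => i _; rewrite mulrA.
    by congr (_ * u _); lia.
  - by move=> i ij; apply: hb; lia.
  - by rewrite /N; lia.
apply: eq_bigr => i _; rewrite (@lmulE f h a b (a + b + i%:Z) N) //; last first.
  by case: i => i /= iN; lia.
rewrite mulr_suml; apply: eq_bigr => j _; congr (_ * h _ * _); lia.
Qed.

Lemma lmul_mono0l (x : R) f k : lmul (lmono 0 x) f k = x * f k.
Proof.
have [a fa] := lcoef_bounded f.
rewrite (@lmulE _ f 0 a k (absz (k - a)%R).+1) //; last by lia.
- by rewrite big_ord_recl /= big1 ?addr0 ?subr0 // => i _; rewrite mul0r.
- by move=> i; rewrite /=; case: eqP => // ->; rewrite ltxx.
Qed.

Lemma lmul_mono0r (x : R) f k : lmul f (lmono 0 x) k = f k * x.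
Proof.
have [a fa] := lcoef_bounded f.
have x0 i : i < 0 -> lmono 0 x i = 0.
  by rewrite /=; case: eqP => // ->; rewrite ltxx.
have [ka|ak] := ltP k a.
  by rewrite (@lmulE f _ a 0 k 0) ?big_ord0 ?fa ?mul0r // ?addr0.
rewrite (@lmulE f _ a 0 k (absz (k - a)%R).+1) //; last by lia.
rewrite big_ord_recr /= big1 ?add0r.
  have -> : a + (absz (k - a)%R)%:Z = k by lia.
  by have -> : k - a - (absz (k - a)%R)%:Z = 0 by lia.
move=> [i iN] _ /=; case: eqP => [e|_]; last by rewrite mulr0.
by exfalso; lia.
Qed.

Definition lone : laurent R := lmono 0 1.

Fact lmul1 : left_id lone lmul.
Proof. by move=> f; apply: laurentP => k; rewrite lmul_mono0l mul1r. Qed.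

Fact lmulr1 : right_id lone lmul.
Proof. by move=> f; apply: laurentP => k; rewrite lmul_mono0r mulr1. Qed.

Fact lmulDl : left_distributive lmul +%R.
Proof.
move=> f h u; have [a fa] := lcoef_bounded f.
have [b hb] := lcoef_bounded h; have [c uc] := lcoef_bounded u.
pose m := Num.min a b.
have fm i : i < m -> f i = 0 by rewrite /m lt_min => /andP[/fa].
have hm i : i < m -> h i = 0 by rewrite /m lt_min => /andP[_ /hb].
apply: laurentP => k; pose N := ((absz (k - m - c)%R).+1).
have kN : k < m + c + N%:Z by rewrite /N; lia.
rewrite lcoefD !(@lmulE _ u m c k N) // -?big_split /=.
  by apply: eq_bigr => i _; rewrite mulrDl.
by move=> i im; rewrite fm ?hm ?addr0.
Qed.

Fact lmulDr : right_distributive lmul +%R.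
Proof.
move=> u f h; have [a fa] := lcoef_bounded f.
have [b hb] := lcoef_bounded h; have [c uc] := lcoef_bounded u.
pose m := Num.min a b.
have fm i : i < m -> f i = 0 by rewrite /m lt_min => /andP[/fa].
have hm i : i < m -> h i = 0 by rewrite /m lt_min => /andP[_ /hb].
apply: laurentP => k; pose N := ((absz (k - m - c)%R).+1).
have kN : k < c + m + N%:Z by rewrite /N; lia.
rewrite lcoefD !(@lmulE u _ c m k N) // -?big_split /=.
  by apply: eq_bigr => i _; rewrite mulrDr.
by move=> i im; rewrite fm ?hm ?addr0.
Qed.

HB.instance Definition _ := GRing.Zmodule_isPzRing.Build (laurent R)
  lmulA lmul1 lmulr1 lmulDl lmulDr.

End LaurentRing.

Section LaurentAlgebra.
Context (F : fieldType) (A : pzAlgType F).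

Let sc (a : F) : laurent A := lmono 0 (ascal a).

Fact laurent_ascalD a c : sc (a + c) = sc a + sc c.
Proof.
by apply: laurentP => k; rewrite lcoefD /=; case: ifP; rewrite ?addr0 // ascalD.
Qed.

Fact laurent_ascalM a c : sc (a * c) = sc a * sc c.
Proof.
apply: laurentP => k; rewrite [RHS]lmul_mono0l /=.
by case: ifP; rewrite ?mulr0 // ascalM.
Qed.

Fact laurent_ascal1 : sc 1 = 1.
Proof. by rewrite /sc ascal1. Qed.

Fact laurent_ascalC a f : sc a * f = f * sc a.
Proof. by apply: laurentP => k; rewrite [LHS]lmul_mono0l [RHS]lmul_mono0r ascalC. Qed.

HB.instance Definition _ := PzRing_isPzAlgebra.Build F (laurent A)
  laurent_ascalD laurent_ascalM laurent_ascal1 laurent_ascalC.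

End LaurentAlgebra.

(* V[x]/x^n V[x], by the coefficients of 1, x, ..., x^(n-1).  This is an alias
   because {ffun 'I_n -> V} already carries the pointwise product. *)
Definition trunc (n : nat) (V : Type) : Type := {ffun 'I_n -> V}.

HB.instance Definition _ n (V : zmodType) :=
  GRing.Zmodule.copy (trunc n V) {ffun 'I_n -> V}.
HB.instance Definition _ n (F : fieldType) (V : lmodType F) :=
  GRing.Lmodule.copy (trunc n V) {ffun 'I_n -> V}.

Definition tcoef n V (p : trunc n V) (i : 'I_n) : V := (p : {ffun 'I_n -> V}) i.
Definition tmake n V (c : nat -> V) : trunc n V := [ffun i : 'I_n => c i].

Lemma tcoefE n V (c : nat -> V) i : tcoef (tmake n c) i = c i.
Proof. exact: ffunE. Qed.

Lemma truncP n V (p q : trunc n V) : (forall i, tcoef p i = tcoef q i) -> p = q.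
Proof. by move=> e; apply/ffunP. Qed.

Definition tmap n (V W : Type) (phi : V -> W) (p : trunc n V) : trunc n W :=
  [ffun i => phi (tcoef p i)].

Definition tconv n (U V W : zmodType) (op : U -> V -> W)
    (p : trunc n U) (q : trunc n V) : trunc n W :=
  tmake n (fun k => \sum_(i < n) \sum_(j < n | (i + j == k)%N)
    op (tcoef p i) (tcoef q j)).

Section TruncRing.
Context (n : nat).

Lemma tcoefD (V : zmodType) (p q : trunc n V) i : tcoef (p + q) i = tcoef p i + tcoef q i.
Proof. exact: ffunE. Qed.

Lemma tcoefZ (F : fieldType) (V : lmodType F) a (p : trunc n V) i :
  tcoef (a *: p) i = a *: tcoef p i.
Proof. exact: ffunE. Qed.

Context (R : pzRingType).
Implicit Types p q r : trunc n R.

Definition tmul : trunc n R -> trunc n R -> trunc n R := tconv *%R.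

Let sum3 (p q r : trunc n R) (k : nat) : R := \sum_(i < n) \sum_(j < n) \sum_(l < n)
  if (i + j + l == k)%N then tcoef p i * tcoef q j * tcoef r l else 0.

Let tmulE p q k : tcoef (tmul p q) k =
  \sum_(i < n) \sum_(j < n) if (i + j == k)%N then tcoef p i * tcoef q j else 0.
Proof. by rewrite tcoefE; apply: eq_bigr => i _; rewrite big_mkcond. Qed.

Let sum_ifE (m : nat) (G : R) (P : nat -> bool) :
  (P m -> (m < n)%N) ->
  \sum_(v < n) (if P v then if (m == v)%N then G else 0 else 0) =
  if P m then G else 0.
Proof.
move=> hP; case: ifP => Pm.
  rewrite (bigD1 (Ordinal (hP Pm))) //= Pm eqxx big1 ?addr0 // => v.
  rewrite -val_eqE /= => vm; case: ifP => // _.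
  by rewrite eq_sym (negPf vm).
by apply: big1 => v _; case: ifP => // Pv; case: eqP => // e; rewrite e Pv in Pm.
Qed.

Fact tmulA : associative tmul.
Proof.
move=> p q r; apply: truncP => k; transitivity (sum3 p q r k).
  rewrite tmulE; apply: eq_bigr => i _.
  under eq_bigr do rewrite tmulE.
  transitivity (\sum_(v < n) \sum_(j < n) \sum_(l < n)
    if (i + v == k)%N then if (j + l == v)%N then tcoef p i * tcoef q j * tcoef r l
    else 0 else 0).
    apply: eq_bigr => v _; case: ifP => _; last by rewrite big1 // => ? _; rewrite big1.
    rewrite mulr_sumr; apply: eq_bigr => j _; rewrite mulr_sumr; apply: eq_bigr => l _.
    by case: ifP => _; rewrite ?mulr0 ?mulrA.
  rewrite exchange_big; apply: eq_bigr => j _; rewrite exchange_big; apply: eq_bigr => l _.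
  rewrite (@sum_ifE (j + l) _ (fun v => i + v == k)%N) //= ?addnA //.
  by move=> /eqP e; have := ltn_ord k; lia.
have -> : sum3 p q r k = \sum_(l < n) \sum_(i < n) \sum_(j < n)
    if (i + j + l == k)%N then tcoef p i * tcoef q j * tcoef r l else 0.
  rewrite /sum3 [RHS]exchange_big; apply: eq_bigr => i _ /=.
  by rewrite exchange_big.
symmetry; rewrite tmulE exchange_big; apply: eq_bigr => l _ /=.
transitivity (\sum_(v < n) \sum_(i < n) \sum_(j < n)
    if (v + l == k)%N then if (i + j == v)%N then tcoef p i * tcoef q j * tcoef r l
    else 0 else 0).
  apply: eq_bigr => v _; rewrite tmulE; case: ifP => _; last by rewrite big1 // => ? _; rewrite big1.
  rewrite mulr_suml; apply: eq_bigr => j _; rewrite mulr_suml; apply: eq_bigr => i _.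
  by case: ifP => _; rewrite ?mul0r.
rewrite exchange_big; apply: eq_bigr => i _; rewrite exchange_big; apply: eq_bigr => j _.
rewrite (@sum_ifE (i + j) _ (fun v => v + l == k)%N) //=.
by move=> /eqP e; have := ltn_ord k; lia.
Qed.

Definition tconst (x : R) : trunc n R := tmake n (fun k => if k == 0%N then x else 0).

Lemma tconst_mul x (p : trunc n R) i : tcoef (tmul (tconst x) p) i = x * tcoef p i.
Proof.
rewrite tcoefE.
have n0 : (0 < n)%N by case: i => i; apply: leq_ltn_trans.
rewrite (bigD1 (Ordinal n0)) //= [X in _ + X]big1 ?addr0 => [|j j0].
  by rewrite (big_pred1 i) ?tcoefE.
apply: big1 => k _; rewrite tcoefE; move: j0; rewrite -val_eqE /= => /negPf->.
by rewrite mul0r.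
Qed.

Lemma mul_tconst x (p : trunc n R) i : tcoef (tmul p (tconst x)) i = tcoef p i * x.
Proof.
rewrite tcoefE.
have n0 : (0 < n)%N by case: i => i; apply: leq_ltn_trans.
under eq_bigr do rewrite big_mkcond.
rewrite exchange_big (bigD1 (Ordinal n0)) //= [X in _ + X]big1 ?addr0 => [|j j0].
  rewrite -big_mkcond (big_pred1 i) ?tcoefE // => k.
  by rewrite /= addn0 -val_eqE.
apply: big1 => k _; rewrite tcoefE; move: j0; rewrite -val_eqE /= => /negPf->.
by rewrite mulr0 if_same.
Qed.

Definition tone : trunc n R := tconst 1.

Fact tmul1 : left_id tone tmul.
Proof. by move=> p; apply: truncP => k; rewrite tconst_mul mul1r. Qed.

Fact tmulr1 : right_id tone tmul.
Proof. by move=> p; apply: truncP => k; rewrite mul_tconst mulr1. Qed.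

Fact tmulDl : left_distributive tmul +%R.
Proof.
move=> p q r; apply: truncP => k; rewrite tcoefD !tcoefE -big_split.
apply: eq_bigr => i _; rewrite -big_split; apply: eq_bigr => j _.
by rewrite tcoefD mulrDl.
Qed.

Fact tmulDr : right_distributive tmul +%R.
Proof.
move=> p q r; apply: truncP => k; rewrite tcoefD !tcoefE -big_split.
apply: eq_bigr => i _; rewrite -big_split; apply: eq_bigr => j _.
by rewrite tcoefD mulrDr.
Qed.

HB.instance Definition _ := GRing.Zmodule_isPzRing.Build (trunc n R)
  tmulA tmul1 tmulr1 tmulDl tmulDr.

End TruncRing.

Section TruncAlgebra.
Context (n : nat) (F : fieldType) (A : pzAlgType F).

Let sc (a : F) : trunc n A := tconst n (ascal a).

Fact trunc_ascalD a c : sc (a + c) = sc a + sc c.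
Proof.
by apply: truncP => i; rewrite tcoefD !tcoefE; case: ifP; rewrite ?addr0 // ascalD.
Qed.

Fact trunc_ascalM a c : sc (a * c) = sc a * sc c.
Proof.
apply: truncP => i; rewrite [RHS]tconst_mul !tcoefE.
by case: ifP; rewrite ?mulr0 // ascalM.
Qed.

Fact trunc_ascal1 : sc 1 = 1.
Proof. by rewrite /sc ascal1. Qed.

Fact trunc_ascalC a p : sc a * p = p * sc a.
Proof. by apply: truncP => i; rewrite [LHS]tconst_mul [RHS]mul_tconst ascalC. Qed.

HB.instance Definition _ := PzRing_isPzAlgebra.Build F (trunc n A)
  trunc_ascalD trunc_ascalM trunc_ascal1 trunc_ascalC.

End TruncAlgebra.

Notation adj n V := (laurent V * trunc n V)%type.

Section Adj.
Context (n : nat).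

(* The image (c, [c]) of a power series c. *)
Definition diag (V : zmodType) (c : nat -> V) : adj n V := (lser c, tmake n c).

Definition adj_const (V : zmodType) (v : V) : adj n V :=
  diag (fun k => if k == 0%N then v else 0).

Definition adj_map (V W : zmodType) (phi : V -> W) (phi0 : phi 0 = 0)
    (u : adj n V) : adj n W :=
  (lmap phi0 u.1, tmap phi u.2).

Definition adj_conv (U V W : zmodType) (op : U -> V -> W)
    (op0l : forall v, op 0 v = 0) (op0r : forall u, op u 0 = 0)
    (u : adj n U) (v : adj n V) : adj n W :=
  (lconv op0l op0r u.1 v.1, tconv op u.2 v.2).

(* The action s . (f, [p]) = (s f, [s p]) of a power series s. *)
Definition adj_smul (F : fieldType) (V : lmodType F) (s : nat -> F) (u : adj n V) :
    adj n V :=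
  @adj_conv F V V *:%R (@scale0r F V) (@scaler0 F V) (diag (s : nat -> F)) u.

End Adj.

Definition is_subspace (F : fieldType) (V : lmodType F) (S : set V) : Prop :=
  S 0 /\ forall (a : F) u v, S u -> S v -> S (a *: u + v).

Definition lspan (F : fieldType) (V : lmodType F) (S : set V) : set V :=
  smallest (@is_subspace F V) S.

Definition complementary (F : fieldType) (V : lmodType F) (S T : set V) : Prop :=
  (forall u, exists x y, [/\ S x, T y & u = x + y]) /\ S `&` T `<=` [set 0].

Section Manin.
Context (F : fieldType) (n : nat) (alpha : int -> F).

(* Only the values alpha_i with i <= n - 2 are read. *)
Definition alpha_coef (m : int) : F :=
  if m == - n%:Z then 1 else if - n%:Z < m then alpha (- m - 1) else 0.

Fact alpha_bounded : lbounded alpha_coef.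
Proof.
by exists (- n%:Z) => k kn; rewrite /alpha_coef lt_eqF // ltNge (ltW kn).
Qed.

Definition alpha_ser : laurent F := Laurent alpha_bounded.

(* The polynomial representative of degree < n. *)
Definition tpoly (p : trunc n F) : laurent F :=
  lser (fun k => if insub k is Some i then tcoef p i else 0).

(* t (f, [p]) *)
Definition res_form (u : adj n F) : F := (alpha_ser * (u.1 - tpoly u.2)) (-1).

Context (g : lieAlgType F).
Implicit Types u v : adj n g.

Definition adj_lie u v : adj n g := adj_conv (@lie0x F g) (@liex0 F g) u v.

(* The extension of kappa to L(n, alpha), with values in A(n, alpha), followed
   by t. *)
Definition bilform u v : F :=
  res_form (adj_conv (@killing0x F g) (@killingx0 F g) u v).

Definition diag_set : set (adj n g) := range (@diag n g).

Definition lagrangian (V : set (adj n g)) : Prop :=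
  V = [set u | forall v, V v -> bilform u v = 0].

Definition is_subalgebra (V : set (adj n g)) : Prop :=
  is_subspace V /\ forall u v, V u -> V v -> V (adj_lie u v).

End Manin.

(* An element sum_(k, i) f_(k, i) (x) b_i y^k of (L (x) g)[[y]] is the family
   r k i = f_(k, i); an element of (g (x) g)[[x, y]] is the family G of the
   matrices of its coefficients: G l k j i is the coefficient of
   (b_j (x) b_i) x^l y^k. *)

Section Series.
Context (F : fieldType) (n d : nat) (g : lieAlgType F) (b : d.-tuple g).
Context (s : nat -> F).

Definition series := nat -> 'I_d -> adj n g.

(* y^n Omega / (x - y) *)
Definition wbase : series := fun k i =>
  if (k < n)%N then (0, - tmake n (fun m => if m == (n - 1 - k)%N then b`_i else 0))
  else (lmono (n%:Z - 1 - k%:Z) b`_i, 0).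

(* An element of (g (x) g)[[x, y]], through g[[x]] = diag_set. *)
Definition power_part (G : nat -> nat -> 'M[F]_d) : series := fun k i =>
  diag n (fun l => \sum_(j < d) G l k j i *: b`_j).

Definition ns_series (G : nat -> nat -> 'M[F]_d) : series := fun k i =>
  adj_smul s (wbase k i) + power_part G k i.

Definition ns_type (r : series) : Prop := exists G, r = ns_series G.

(* Recovers G from ns_series G (g(x, y) is determined by r). *)
Definition regular_part (r : series) (l k : nat) : 'M[F]_d :=
  \matrix_(j, i) coord b j ((r k i - adj_smul s (wbase k i)).1 l%:Z).

(* Coefficients of s(x) y^n - s(y) x^n and of its quotient by x - y: if
   p = (x - y) q then q_(l, k) = p_(l+1, k) + q_(l+1, k-1). *)
Definition num_coef (l k : nat) : F := s l * (k == n)%:R - s k * (l == n)%:R.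

Definition quot_coef (l k : nat) : F :=
  \sum_(j < k.+1) num_coef (l.+1 + j) (k - j).

(* s(x) y^n Omega / (x - y) - q(x, y) Omega - tau (g(y, x)): the coefficient
   matrix of Omega is 1, and that of x^l y^k in tau (g(y, x)) is the transpose
   of that of x^k y^l in g. *)
Definition ns_bar (r : series) : series :=
  ns_series (fun l k => - (quot_coef l k)%:M - (regular_part r k l)^T).

Definition skew_symmetric (r : series) : Prop := r = ns_bar r.

Definition wspan (r : series) : set (adj n g) :=
  lspan [set r k i | k in [set: nat] & i in [set: 'I_d]].

(* (x - y) q = p *)
Lemma quot_coefP l k :
  (if l is l'.+1 then quot_coef l' k else 0) -
  (if k is k'.+1 then quot_coef l k' else 0) = num_coef l k.
Proof.
case: l k => [|l] [|k].
- by rewrite /num_coef !subrr.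
- rewrite sub0r; apply/esym/eqP; rewrite -subr_eq0 opprK; apply/eqP.
  transitivity (\sum_(j < k.+2) num_coef j (k.+1 - j)).
    by rewrite [RHS]big_ord_recl subn0.
  rewrite /num_coef sumrB; apply/eqP; rewrite subr_eq0; apply/eqP.
  rewrite (reindex_inj rev_ord_inj); apply: eq_bigr => j _ /=.
  by rewrite subSS subKn // -ltnS.
- by rewrite subr0 /quot_coef big_ord1 addn0.
- rewrite /quot_coef big_ord_recl addn0 subn0 -addrA -sumrB big1 ?addr0 // => j _.
  by rewrite /= /bump /= !add1n subSS addnS addSn subrr.
Qed.

Notation A1 := (adj n F).
Notation A2 := (adj n A1).
Notation A3 := (adj n A2).

Definition U3A3 : pzAlgType F := tens (tens (tens (env g) (env g)) (env g)) A3.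

Definition tensor4 (x y z : env g) (u : A3) : U3A3 :=
  tensor (tensor (tensor x y) z) u.

Definition coef_in (A : pzAlgType F) (j : 'I_d) (v : g) : A :=
  ascal (coord b j v).

Fact coef_in0 (A : pzAlgType F) (j : 'I_d) : coef_in A j 0 = 0.
Proof. by rewrite /coef_in linear0 ascal0. Qed.

(* f in L(n, alpha) is the sum over j of b_j (x) f_j with f_j in A(n, alpha);
   this is f_j, with its coefficients seen in an algebra A over F. *)
Definition lcoord (A : pzAlgType F) (j : 'I_d) (f : adj n g) : adj n A :=
  adj_map (coef_in0 A j) f.

(* By finite-dimensionality of g, the infinite sums over k can be carried out
   in A_2 or A_3, for each pair of basis vectors: x_m^k is (x_m^k, [x_m]^k), so
   they are diagonal elements, and A_m embeds in A_(m+1) by adj_const. *)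
Definition r12 (r : series) : U3A3 :=
  \sum_(i < d) \sum_(j < d) tensor4 (envi b`_j) (envi b`_i) 1
    (adj_const n (diag n (fun k => lcoord F j (r k i)))).

Definition r13 (r : series) : U3A3 :=
  \sum_(i < d) \sum_(j < d) tensor4 (envi b`_j) 1 (envi b`_i)
    (diag n (fun k => adj_const n (lcoord F j (r k i)))).

Definition r23 (r : series) : U3A3 :=
  \sum_(i < d) \sum_(j < d) tensor4 1 (envi b`_j) (envi b`_i)
    (diag n (fun k => lcoord A1 j (r k i))).

Definition gcyb (r : series) : U3A3 :=
  commutator (r12 r) (r13 r) + commutator (r12 r) (r23 r)
  + commutator (r13 r) (r23 (ns_bar r)).

End Series.

(* Main.v *)
From HB Require Import structures.
Require Import Defs.
From mathcomp Require Import all_boot all_order all_algebra.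
From mathcomp Require Import boolp classical_sets functions.
From mathcomp Require Import zify.

Set Implicit Arguments.
Unset Strict Implicit.
Unset Printing Implicit Defensive.

Import Order.TTheory GRing.Theory Num.Theory.

Local Open Scope classical_set_scope.
Local Open Scope ring_scope.

(** Write Delta for the diagonal, B for the form on L = L(n, alpha), and w_(k, i)
    for the coefficients of y^n Omega / (x - y).

    The form turns both statements into linear algebra.  Since s alpha = x^(-n),
    the elements s w_(k, i) are dual to the elements b_i x^k of Delta:
    B (s w_(k, i), c) is the coordinate along b_i of the coefficient of x^k in c
    (bilform_sw_diag).  Moreover Delta is its own orthogonal (bilform_diag,
    diag_perp), and a given element of L is orthogonal to b_i x^k for all large k
    (bilform_gmono_fin).  An (n, s)-type series is a family r_(k, i) in
    s w_(k, i) + Delta, so it is again dual to the b_i x^k; hence W(r) is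
    complementary to Delta, with projection P u = sum B (u, b_i x^k) r_(k, i)
    (wspan_compl).  Conversely a complement V is W(r) for exactly one r, whose
    coefficients are the projections to V of the s w_(k, i) along Delta
    (ns_type_exists, wspan_inj).

    Part 1.  The numbers B (s w_(k, i), s w_(l, j)) are the coefficients of the
    quotient (s(x) y^n - s(y) x^n) / (x - y) times Omega (res_form_ww), and this
    gives B (rbar_(k, i), r_(l, j)) = 0 for every series r (bilform_bar).  So if
    r = rbar then W(r) is isotropic, and an isotropic complement of the Lagrangian
    Delta is Lagrangian; if W(r) is Lagrangian then it contains rbar - r, whose
    coefficients also lie in Delta, so rbar = r.

    Part 2.  Apply a linear form f on L to the first tensor factor of GCYB(r), and
    take the coefficient of b_c x_3^k in the third: this leaves an element E of L
    in the second factor (defect).  With D_f in Delta the element representing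
    f o P (dual_diagE) and h = r_(k, c), invariance of B gives
    B (E, v) = f ([v, h] + P [h, v]) for v in W(r): the third commutator has its
    second factor in W(rbar), which is orthogonal to W(r).  On Delta the form
    B (E, .) vanishes for every r, since the contributions of the second and of
    the third commutator cancel.  As Delta + W(r) = L, all E vanish if and only if
    [v, h] = P [v, h] for all v and h in W(r), i.e., W(r) is a subalgebra
    (subalgebra_defect).

    It remains to see that GCYB(r) = 0 is detected by its coefficients with respect
    to the elements b_m (x) b_i (x) b_j of the tensor cube of U(g).  The adjoint
    representation suffices: it maps the tensor cube of U(g), with coefficients in a
    commutative algebra, to iterated matrices, where the coefficients are
    recovered by traces because trace (ad b_i ad b_j) is the Kronecker symbol
    (tens4_basis_free). *)

(** * Products of Laurent series and of truncated polynomials *)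

Section Laurent.
Context (R : pzRingType).
Implicit Types f h : laurent R.

Lemma lmono_mulE m (x : R) f k : (lmono m x * f) k = x * f (k - m).
Proof.
have [a fa] := lcoef_bounded f.
have mb i : i < m -> lmono m x i = 0 by rewrite /=; case: eqP => // ->; rewrite ltxx.
have [ka|ak] := ltP (k - m) a.
  by rewrite [LHS](@lmulE _ _ _ m a k 0) ?big_ord0 ?fa ?mulr0 //; lia.
rewrite [LHS](@lmulE _ _ f m a k (absz (k - m - a)%R).+1) //; last by lia.
rewrite big_ord_recl /= big1 ?addr0 ?eqxx ?subr0 // => i _.
by case: eqP => [|_]; [rewrite /bump; lia|rewrite mul0r].
Qed.

Definition psmul (c e : nat -> R) (k : nat) : R := \sum_(i < k.+1) c i * e (k - i)%N.

Lemma lser_mul (c e : nat -> R) : lser c * lser e = lser (psmul c e).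
Proof.
have ps (a : nat -> R) i : i < 0 -> lser a i = 0 by case: i.
apply: laurentP => -[k|k]; last first.
  by rewrite [LHS](@lmulE _ _ _ 0 0 _ 0) ?big_ord0 //; exact: ps.
rewrite [LHS](@lmulE _ _ _ 0 0 _ k.+1); [|exact: ps|exact: ps|lia].
apply: eq_bigr => -[i ik] _; rewrite add0r subr0 [lcoef (lser c) _]/=; congr (_ * _).
rewrite [Posz (Ordinal _)]/=.
by have -> : k%:Z - i%:Z = (k - i)%N%:Z by lia.
Qed.

Lemma tmake_mul n (c e : nat -> R) : tmake n c * tmake n e = tmake n (psmul c e).
Proof.
apply: truncP => k; rewrite [LHS]tcoefE tcoefE /psmul.
under eq_bigr do rewrite big_mkcond.
rewrite (big_ord_widen n (fun i => c i * e (k - i)%N)) ?ltn_ord // [RHS]big_mkcond.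
apply: eq_bigr => i _; case: ltnP => ik; last first.
  by rewrite big1 // => j _; case: eqP => // e1; exfalso; lia.
have kin : (k - i < n)%N by have := ltn_ord k; lia.
rewrite (bigD1 (Ordinal kin)) //= subnKC ?eqxx // big1 ?addr0 ?tcoefE //.
move=> j; rewrite -val_eqE /= => jk; case: eqP => // e1; exfalso; lia.
Qed.

Lemma diag_mul n (c e : nat -> R) : diag n c * diag n e = diag n (psmul c e).
Proof. by congr pair; [exact: lser_mul|exact: tmake_mul]. Qed.

Lemma psmul_constl x (c : nat -> R) :
  psmul (fun k => if k == 0%N then x else 0) c = (fun k => x * c k).
Proof.
apply/funext => k; rewrite /psmul big_ord_recl subn0 /= big1 ?addr0 // => i _.
by rewrite mul0r.
Qed.

Lemma psmul_delta l (c : nat -> R) k :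
  psmul (fun m => if m == l then 1 else 0) c k = if (l <= k)%N then c (k - l)%N else 0.
Proof.
rewrite /psmul; case: leqP => lk.
  rewrite (bigD1 (Ordinal (n:=k.+1) (m:=l) lk)) //= eqxx mul1r big1 ?addr0 // => i.
  by rewrite -val_eqE /= => /negPf ->; rewrite mul0r.
rewrite big1 // => -[i ik] _ /=; case: eqP => [|_]; last by rewrite mul0r.
by move=> il; exfalso; lia.
Qed.

Lemma adj_const_mul n x (c : nat -> R) :
  adj_const n x * diag n c = diag n (fun k => x * c k).
Proof. by rewrite diag_mul psmul_constl. Qed.

Lemma diag_inj n (V : zmodType) : injective (@diag n V).
Proof.
by move=> c e h; apply/funext => k; exact: (congr1 (fun u : adj n V => u.1 k%:Z) h).
Qed.

Lemma lmulC : (forall x y : R, x * y = y * x) -> forall f h : laurent R, f * h = h * f.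
Proof.
move=> mC f h; have [a fa] := lcoef_bounded f; have [c hc] := lcoef_bounded h.
apply: laurentP => k; have [kl|lk] := ltP k (a + c).
  by rewrite [LHS](@lmulE _ _ _ a c k 0) ?[RHS](@lmulE _ _ _ c a k 0) ?big_ord0 ?addr0 // addrC.
(* f and h vanish below a and c, so only N + 1 terms can be nonzero at k. *)
pose N := absz (k - a - c)%R.
rewrite [LHS](@lmulE _ _ _ a c k N.+1)
  ?[RHS](@lmulE _ _ _ c a k N.+1) //; try by rewrite /N; lia.
rewrite (reindex_inj rev_ord_inj); apply: eq_bigr => -[i iN] _ /=.
by rewrite mC; congr (h _ * f _); rewrite subSS /N in iN *; lia.
Qed.

Lemma tmulC n : (forall x y : R, x * y = y * x) -> forall p q : trunc n R, p * q = q * p.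
Proof.
move=> mC p q; apply: truncP => k; rewrite [LHS]tcoefE [RHS]tcoefE.
under eq_bigr do rewrite big_mkcond.
under [RHS]eq_bigr do rewrite big_mkcond.
rewrite exchange_big; apply: eq_bigr => i _; apply: eq_bigr => j _.
by rewrite addnC mC.
Qed.

Lemma adj_mulC n : (forall x y : R, x * y = y * x) -> forall u v : adj n R, u * v = v * u.
Proof. by move=> mC [f p] [h q]; congr pair; [exact: lmulC|exact: tmulC]. Qed.

End Laurent.

Section ConvCoord.
Context (n : nat) (U V W : zmodType) (R : pzRingType) (op : U -> V -> W).
Context (op0l : forall v, op 0 v = 0) (op0r : forall u, op u 0 = 0).
Context (phi : W -> R) (phi0 : phi 0 = 0) (phiD : {morph phi : x y / x + y}).
Context (I : finType) (ph : I -> U -> R) (ps : I -> V -> R).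
Context (ph0 : forall i, ph i 0 = 0) (ps0 : forall i, ps i 0 = 0).
Hypothesis op_coord : forall x y, phi (op x y) = \sum_i ph i x * ps i y.

(** A convolution is determined by coordinates: if phi (op x y) is a sum of products
    of coordinates of x and y, the same formula holds for series.  It is used for
    the bracket, for the Killing form, for the action of power series, and for
    functionals on coefficients. *)
Lemma adj_conv_coord (u : adj n U) (v : adj n V) :
  adj_map phi0 (adj_conv op0l op0r u v) =
  \sum_i adj_map (ph0 i) u * adj_map (ps0 i) v.
Proof.
have phi_sum (J : finType) (P : pred J) (G : J -> W) :
    phi (\sum_(j | P j) G j) = \sum_(j | P j) phi (G j).
  by apply: (big_morph phi phiD phi0).
have fstS (G : I -> adj n R) : (\sum_i G i).1 = \sum_i (G i).1.
  by apply: (big_morph (fun x : adj n R => x.1)).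
have sndS (G : I -> adj n R) : (\sum_i G i).2 = \sum_i (G i).2.
  by apply: (big_morph (fun x : adj n R => x.2)).
have [a ua] := lcoef_bounded u.1; have [c vc] := lcoef_bounded v.1.
apply: injective_projections; rewrite ?fstS ?sndS /=.
  apply: laurentP => k.
  have -> : (\sum_i lmap (ph0 i) u.1 * lmap (ps0 i) v.1) k =
      \sum_i (lmap (ph0 i) u.1 * lmap (ps0 i) v.1) k.
    by apply: (big_morph (fun x : laurent R => x k)).
  pose N := (absz (k - a - c)%R).+1.
  rewrite /= (@lconv_coefE _ _ _ op _ _ _ _ a c k N) //; last by rewrite /N; lia.
  rewrite phi_sum; under [LHS]eq_bigr do rewrite op_coord.
  rewrite exchange_big; apply: eq_bigr => i _; apply/esym.
  rewrite [LHS](@lmulE _ _ _ a c k N) //; last by rewrite /N; lia.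
    by move=> j /ua /= ->.
  by move=> j /vc /= ->.
apply: truncP => k.
have -> : tcoef (\sum_i tmap (ph i) u.2 * tmap (ps i) v.2) k =
    \sum_i tcoef (tmap (ph i) u.2 * tmap (ps i) v.2) k.
  by apply: (big_morph (fun x : trunc n R => tcoef x k));
    [move=> x y; exact: tcoefD|exact: ffunE].
rewrite /tcoef ffunE -/(tcoef _ _) tcoefE phi_sum.
under [LHS]eq_bigr => i _ do
  (rewrite phi_sum; under eq_bigr do rewrite op_coord; rewrite exchange_big).
rewrite exchange_big; apply: eq_bigr => i _; rewrite [RHS]tcoefE.
by apply: eq_bigr => j _; apply: eq_bigr => l _; rewrite /tcoef !ffunE.
Qed.

End ConvCoord.

Lemma tmapE n (V W : Type) (phi : V -> W) (p : trunc n V) i :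
  tcoef (tmap phi p) i = phi (tcoef p i).
Proof. exact: ffunE. Qed.

Section AdjMap.
Context (n : nat) (V W : zmodType).

Lemma adj_mapD (phi : V -> W) (phi0 : phi 0 = 0) : {morph phi : x y / x + y} ->
  {morph adj_map phi0 : u v / u + v : adj n V >-> u + v : adj n W}.
Proof.
move=> pD u v; congr pair; first by apply: laurentP => k; exact: pD.
by apply: truncP => i; rewrite tcoefD !tmapE tcoefD pD.
Qed.

Lemma adj_map_diag (phi : V -> W) (phi0 : phi 0 = 0) c :
  adj_map phi0 (diag n c) = diag n (fun k => phi (c k)).
Proof.
congr pair; first by apply: laurentP => -[].
by apply: truncP => i; rewrite tmapE !tcoefE.
Qed.

Lemma diagD (c e : nat -> V) : diag n c + diag n e = diag n (fun k => c k + e k).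
Proof.
congr pair; first by apply: laurentP => -[] k; rewrite lcoefD /= ?addr0.
by apply: truncP => i; rewrite /tcoef !ffunE.
Qed.

Lemma diag0 : diag n (fun _ => 0 : V) = 0.
Proof.
apply: injective_projections; first by apply: laurentP => -[].
by apply: truncP => i; rewrite tcoefE.
Qed.

Lemma diag_sum (I : Type) (r : seq I) (P : pred I) (c : I -> nat -> V) :
  \sum_(i <- r | P i) diag n (c i) = diag n (fun k => \sum_(i <- r | P i) c i k).
Proof.
have -> : (fun k => \sum_(i <- r | P i) c i k) = \sum_(i <- r | P i) c i.
  by apply/funext => k; rewrite fct_sumE.
elim/big_rec2: _ => [|i u v _ ->]; first by rewrite -diag0.
by rewrite diagD.
Qed.
End AdjMap.

Lemma adj_map_id n (V : zmodType) (id0 : (fun x : V => x) 0 = 0) (u : adj n V) :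
  adj_map id0 u = u.
Proof.
apply: injective_projections; first by apply: laurentP.
by apply: truncP => i; rewrite tmapE.
Qed.

Lemma ascal_adj_const (F : fieldType) n (A : pzAlgType F) (a : F) :
  ascal a = adj_const n (ascal a) :> adj n A.
Proof. by congr pair; apply: laurentP => -[[|k]|k]. Qed.

Lemma psmul_constr (R : pzRingType) x (c : nat -> R) :
  psmul c (fun k => if k == 0%N then x else 0) = (fun k => c k * x).
Proof.
apply/funext => k; rewrite /psmul big_ord_recr /= subnn /= big1 ?add0r // => -[i ik] _ /=.
by rewrite ifF ?mulr0 //; apply/negP; rewrite subn_eq0 leqNgt ik.
Qed.

Lemma mul_adj_const (R : pzRingType) n x (c : nat -> R) :
  diag n c * adj_const n x = diag n (fun k => c k * x).
Proof. by rewrite diag_mul psmul_constr. Qed.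

Lemma ascal_diag (F : fieldType) n (A : pzAlgType F) (a : F) (c : nat -> A) :
  ascal a * diag n c = diag n (fun k => ascal a * c k).
Proof. by rewrite ascal_adj_const adj_const_mul. Qed.

Lemma ascal_sum_diag (F : fieldType) n (A : pzAlgType F) (I J : finType)
    (a : I -> J -> F) (c : I -> J -> nat -> A) :
  \sum_p \sum_q ascal (a p q) * diag n (c p q) =
  diag n (fun k => \sum_p \sum_q ascal (a p q) * c p q k).
Proof.
rewrite -diag_sum; apply: eq_bigr => p _; rewrite -diag_sum; apply: eq_bigr => q _.
by rewrite ascal_diag.
Qed.

(** Multiplying by a series with coefficients in the image of phi is a convolution,
    which brings such products within reach of [adj_conv_coord]. *)
Lemma mul_adj_map (R : pzRingType) (V : zmodType) n (phi : V -> R) (phi0 : phi 0 = 0)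
    (op0l : forall z, 0 * phi z = 0) (op0r : forall y, y * phi 0 = 0)
    (U : adj n R) (v : adj n V) :
  U * adj_map phi0 v = adj_conv (op := fun y z => y * phi z) op0l op0r U v.
Proof.
case: U => f p; apply: injective_projections; first by apply: laurentP.
apply: truncP => k; rewrite [LHS]tcoefE [RHS]tcoefE.
by apply: eq_bigr => i _; apply: eq_bigr => l _; rewrite tmapE.
Qed.

Lemma diag_eq0 n (V : zmodType) (c : nat -> V) : diag n c = 0 <-> forall k, c k = 0.
Proof.
rewrite -(diag0 n V); split=> [/diag_inj -> //|e].
by congr (diag n _); apply/funext.
Qed.

(** * The residue form on scalars *)

Section Residue.
Context (F : fieldType) (n : nat) (alpha : int -> F).
Notation al := (alpha_ser n alpha : laurent F).
Notation t := (@res_form F n alpha).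
Implicit Types (f h : laurent F) (p q : trunc n F) (u v : adj n F).

(** The factor in A(n, alpha) of the coefficient w_(k, i) = b_i (x) w_k of
    y^n Omega / (x - y). *)
Definition wscalar (k : nat) : adj n F :=
  if (k < n)%N then (0, - tmake n (fun m => if m == (n - 1 - k)%N then 1 else 0))
  else (lmono (n%:Z - 1 - k%:Z) 1, 0).

Lemma laurent_mulC f h : f * h = h * f.
Proof. by apply: lmulC => x y; exact: mulrC. Qed.

Lemma adjF_mulC u v : u * v = v * u.
Proof. by apply: adj_mulC => x y; exact: mulrC. Qed.

Lemma tmake_lift p : exists c, p = tmake n c.
Proof.
exists (fun k => if insub k is Some i then tcoef p i else 0).
by apply: truncP => i; rewrite tcoefE valK.
Qed.

Lemma alpha_low k : k < - n%:Z -> (al : laurent F) k = 0.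
Proof. by move=> kn; rewrite /= /alpha_coef lt_eqF // ltNge (ltW kn). Qed.

Lemma tpoly_lift (c : nat -> F) k : k < n%:Z -> tpoly (tmake n c) k = lser c k.
Proof.
case: k => //= k kn; case: insubP => [i _ <-|]; first by rewrite tcoefE.
by rewrite -ltz_nat kn.
Qed.

(** The residue form only sees [p] modulo x^n: a power series divisible by x^n has
    zero residue against alpha, so that any lift c of [p] can be used. *)
Lemma res_form_lift f c : t (f, tmake n c) = ((al : laurent F) * (f - lser c)) (-1).
Proof.
rewrite /res_form [(_, _).1]/= [(_, _).2]/=; apply/eqP.
rewrite -subr_eq0 -lcoefN -lcoefD -mulrBr.
rewrite opprB addrC addrA addrNK; apply/eqP.
rewrite [LHS](@lmulE _ _ _ (- n%:Z) n%:Z (-1) 0) ?big_ord0 //; first exact: alpha_low.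
  by move=> i ilt; rewrite lcoefD lcoefN tpoly_lift // subrr.
by rewrite addNr.
Qed.

Lemma res_form_zmod : zmod_morphism t.
Proof.
move=> [f p] [h q]; have [c ->] := tmake_lift p; have [e ->] := tmake_lift q.
have -> : (f, tmake n c) - (h, tmake n e) = (f - h, tmake n (fun k => c k - e k)).
  by congr pair; apply: truncP => i; rewrite /tcoef !ffunE.
rewrite !res_form_lift.
have -> : f - h - lser (fun k => c k - e k) = (f - lser c) - (h - lser e).
  apply: laurentP => -[k|k]; rewrite !lcoefD !lcoefN !lcoefD !lcoefN /=; last by rewrite !subr0.
  by rewrite [in LHS]opprD [in RHS]opprD addrACA.
by rewrite mulrBr lcoefD lcoefN.
Qed.

Lemma res_formD u v : t (u + v) = t u + t v.
Proof.
have t0 : t 0 = 0 by rewrite -[X in t X](subrr 0) res_form_zmod subrr.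
have tN w : t (- w) = - t w by rewrite -sub0r res_form_zmod t0 sub0r.
by rewrite -{1}[v]opprK res_form_zmod tN opprK.
Qed.

Lemma res_form0 : t 0 = 0.
Proof. by rewrite -[X in t X](subrr 0) res_form_zmod subrr. Qed.

Lemma ascal_mulE (a : F) f p : ascal a * (f, p) = (lmono 0 a * f, tconst n a * p) :> adj n F.
Proof. by []. Qed.

Lemma res_formZ a u : t (ascal a * u) = a * t u.
Proof.
case: u => f p; have [c ->] := tmake_lift p; rewrite ascal_mulE.
have -> : tconst n a * tmake n c = tmake n (fun k => a * c k).
  by apply: truncP => i; rewrite [LHS]tconst_mul !tcoefE.
rewrite !res_form_lift.
have -> : lmono 0 a * f - lser (fun k => a * c k) = lmono 0 a * (f - lser c).
  rewrite mulrBr; congr (_ - _); apply: laurentP => -[k|k]; rewrite lmul_mono0l //=.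
  by rewrite mulr0.
by rewrite mulrA [al * _]laurent_mulC -mulrA [LHS]lmul_mono0l.
Qed.

Lemma adj_mulE f p h q : (f, p) * (h, q) = (f * h, p * q) :> adj n F.
Proof. by []. Qed.

(** This is why Delta is isotropic. *)
Lemma res_form_diag c : t (diag n c) = 0.
Proof. by rewrite /diag res_form_lift subrr mulr0. Qed.

Lemma res_form_sum (I : Type) (r : seq I) (P : pred I) (G : I -> adj n F) :
  t (\sum_(i <- r | P i) G i) = \sum_(i <- r | P i) t (G i).
Proof. exact: (big_morph t res_formD res_form0). Qed.

Definition psdelta (l : nat) : nat -> F := fun m => if m == l then 1 else 0.

Lemma lser_psdelta l : lser (psdelta l) = lmono l%:Z 1.
Proof. by apply: laurentP => -[k|k]. Qed.

Lemma mul_diag u e c : u.2 = tmake n e -> u * diag n c = (u.1 * lser c, tmake n (psmul e c)).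
Proof. by case: u => f p /= ->; congr pair; exact: tmake_mul. Qed.

Lemma res_form_psdelta f e l :
  t ((f, tmake n e) * diag n (psdelta l)) = ((al : laurent F) * (f - lser e)) (-1 - l%:Z).
Proof.
rewrite (@mul_diag _ e) // res_form_lift -lser_mul -mulrBl mulrA lser_psdelta.
by rewrite [_ * lmono _ _]laurent_mulC lmono_mulE mul1r.
Qed.

Lemma res_form_fin u : exists N, forall l, (N <= l)%N -> t (u * diag n (psdelta l)) = 0.
Proof.
case: u => f p; have [e ->] := tmake_lift p.
have [a ha] := lcoef_bounded ((al : laurent F) * (f - lser e)).
by exists (absz a) => l al; rewrite res_form_psdelta ha //; lia.
Qed.

Context (s : nat -> F) (s_def : lser s * (lmono n%:Z 1 * al) = 1).

Lemma alpha_mul_s : al * lser s = lmono (- n%:Z) 1.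
Proof.
have e : lmono (- n%:Z) 1 * lmono n%:Z 1 = 1 :> laurent F.
  apply: laurentP => k; rewrite lmono_mulE mul1r /=.
  by case: eqP; case: eqP => //; lia.
have := congr1 (fun f => lmono (- n%:Z) 1 * f) s_def.
rewrite mulr1 mulrA [_ * lser s]laurent_mulC -mulrA [lmono (-_) _ * _]mulrA e mul1r.
by rewrite laurent_mulC.
Qed.

(** Multiplication by alpha s = x^(-n) reduces a residue against s w_k to a
    coefficient: of the polynomial part for k < n, of the Laurent part otherwise. *)
Lemma res_form_w k f c :
  t (diag n s * wscalar k * (f, tmake n c)) = if (k < n)%N then c k else f k%:Z.
Proof.
rewrite /wscalar; case: ltnP => kn.
  have -> : diag n s * (0, - tmake n (psdelta (n - 1 - k))) * (f, tmake n c) =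
    (0, tmake n (fun i => - psmul (psmul s (psdelta (n - 1 - k))) c i)).
    rewrite /diag !adj_mulE mulr0 mul0r mulrN mulNr [tmake n s * _]tmake_mul tmake_mul.
    congr pair.
    by apply: truncP => i; rewrite /tcoef !ffunE.
  rewrite res_form_lift sub0r.
  have -> : - lser (fun i => - psmul (psmul s (psdelta (n - 1 - k))) c i) =
     lser s * lmono (n - 1 - k)%N%:Z 1 * lser c.
    rewrite -lser_psdelta !lser_mul.
    by apply: laurentP => -[i|i]; rewrite lcoefN /= ?opprK ?oppr0.
  rewrite !mulrA alpha_mul_s -mulrA lmono_mulE lmono_mulE !mul1r.
  by have -> : -1 - - n%:Z - (n - 1 - k)%N%:Z = k by lia.
have -> : diag n s * (lmono (n%:Z - 1 - k%:Z) 1, 0) * (f, tmake n c) =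
    (lser s * lmono (n%:Z - 1 - k%:Z) 1 * f, tmake n (fun _ => 0)).
  rewrite /diag !adj_mulE mulr0 mul0r; by congr pair.
rewrite res_form_lift; have -> : lser (fun _ => 0) = 0 :> laurent F.
  by apply: laurentP => -[].
rewrite subr0 !mulrA alpha_mul_s -mulrA !lmono_mulE !mul1r; congr (f _); lia.
Qed.

Lemma res_form_w_diag k c : t (diag n s * wscalar k * diag n c) = c k.
Proof. by rewrite res_form_w /= if_same. Qed.

(** Both sides are supported on k, l < n, with value - s_(k+l+1-n), which is 0 for a
    negative index, and on k, l >= n, with value s_(k+l+1-n). *)
Lemma res_form_ww k l : t (diag n s * wscalar k * (diag n s * wscalar l)) = quot_coef n s l k.
Proof.
have qE : quot_coef n s l k = (if (n <= k)%N then s (k + l + 1 - n)%N else 0) -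
    (if (l < n)%N && (n <= k + l + 1)%N then s (k + l + 1 - n)%N else 0).
  rewrite /quot_coef /num_coef sumrB; congr (_ - _).
    case: leqP => nk.
      have kn : (k - n < k.+1)%N by lia.
      rewrite (bigD1 (Ordinal kn)) //= big1 ?addr0.
        by rewrite subKn // eqxx mulr1; congr s; lia.
      move=> [j jk]; rewrite -val_eqE /= => jn; case: eqP; rewrite ?mulr0 // => e.
      by move/eqP: jn; lia.
    by rewrite big1 // => -[j jk] _ /=; case: eqP; rewrite ?mulr0 //; lia.
  case: ltnP => ln /=; last first.
    by rewrite big1 // => -[j jk] _ /=; case: eqP; rewrite ?mulr0 //; lia.
  case: leqP => nkl.
    have kn : (n - l.+1 < k.+1)%N by lia.
    rewrite (bigD1 (Ordinal kn)) //= big1 ?addr0.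
      by rewrite subnKC // eqxx mulr1; congr s; lia.
    move=> [j jk]; rewrite -val_eqE /= => jn; case: eqP; rewrite ?mulr0 // => e.
    by move/eqP: jn; lia.
  by rewrite big1 // => -[j jk] _ /=; case: eqP; rewrite ?mulr0 //; lia.
rewrite {}qE {2}/wscalar; case: (ltnP l n) => ln /=.
  have -> : diag n s * (0, - tmake n (psdelta (n - 1 - l))) =
      (0, tmake n (fun i => - psmul (psdelta (n - 1 - l)) s i)).
    rewrite adjF_mulC /diag adj_mulE mul0r mulNr tmake_mul; congr pair.
    by apply: truncP => i; rewrite /tcoef !ffunE.
  rewrite res_form_w psmul_delta; case: (ltnP k n) => kn.
    rewrite sub0r; case: leqP => e1; case: leqP => e2; try (by rewrite oppr0); try (by lia).
    by congr (- s _); lia.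
  by rewrite ifT ?subrr //; lia.
have -> : diag n s * (lmono (n%:Z - 1 - l%:Z) 1, 0) =
    (lmono (n%:Z - 1 - l%:Z) 1 * lser s, tmake n (fun _ => 0)).
  rewrite adjF_mulC /diag adj_mulE mul0r; by congr pair.
rewrite res_form_w lmono_mulE mul1r subr0; case: ltnP => kn //.
have -> : k%:Z - (n%:Z - 1 - l%:Z) = (k + l + 1 - n)%N by lia.
by [].
Qed.

(** The hypothesis says that alpha (f - p) has no polar part; as alpha is x^(-n)
    times a unit, f - p is then divisible by x^n. *)
Lemma res_form_perp u : (forall l, t (u * diag n (psdelta l)) = 0) -> exists c, u = diag n c.
Proof.
(* f - e = s x^n q, and by hypothesis q has no coefficient of negative degree. *)
case: u => f p; have [e ->] := tmake_lift p => h.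
pose q := al * (f - lser e).
have q0 k : k < 0 -> q k = 0.
  move=> k0; rewrite -(h (absz k).-1) res_form_psdelta; congr (lcoef q _); lia.
have fe : f - lser e = lser s * lmono n%:Z 1 * q.
  by rewrite /q !mulrA -[_ * _ * al]mulrA s_def mul1r.
have low k : k < n%:Z -> f k = lser e k.
  move=> kn; apply/eqP; rewrite -subr_eq0 -lcoefN -lcoefD fe -mulrA laurent_mulC -mulrA.
  rewrite lmono_mulE mul1r [lcoef _ _](@lmulE _ _ _ 0 0 _ 0) ?big_ord0 //; last first.
    by rewrite !addr0 subr_lt0.
  by case.
exists (fun k => f k%:Z); congr pair.
  apply: laurentP => -[k|k] //=.
  by rewrite low.
by apply: truncP => i; rewrite !tcoefE low // ltz_nat.
Qed.

End Residue.

(** * Invariance of the Killing form *)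

Section Killing.
Context (F : fieldType) (g : lieAlgType F).
Implicit Types x y z : g.

Lemma lieDl x y z : lie (x + y) z = lie x z + lie y z.
Proof. by rewrite -[x in LHS]scale1r liePl scale1r. Qed.
Lemma lieDr x y z : lie z (x + y) = lie z x + lie z y.
Proof. by rewrite -[x in LHS]scale1r liePr scale1r. Qed.
Lemma lieZl a x z : lie (a *: x) z = a *: lie x z.
Proof. by rewrite -[a *: x]addr0 liePl lie0x addr0. Qed.
Lemma lieZr a x z : lie z (a *: x) = a *: lie z x.
Proof. by rewrite -[a *: x]addr0 liePr liex0 addr0. Qed.
Lemma lie_suml (I : Type) (r : seq I) (P : pred I) (G : I -> g) z :
  lie (\sum_(i <- r | P i) G i) z = \sum_(i <- r | P i) lie (G i) z.
Proof. by apply: (big_morph (lie^~ z)) => [x y|]; rewrite ?lieDl ?lie0x. Qed.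
Lemma lie_sumr (I : Type) (r : seq I) (P : pred I) (G : I -> g) z :
  lie z (\sum_(i <- r | P i) G i) = \sum_(i <- r | P i) lie z (G i).
Proof. by apply: (big_morph (lie z)) => [x y|]; rewrite ?lieDr ?liex0. Qed.
Lemma lie_antisym x y : lie x y = - lie y x.
Proof.
have := liexx (x + y); rewrite lieDl !lieDr !liexx add0r addr0 => /eqP.
by rewrite addr_eq0 => /eqP.
Qed.

Definition ad x : 'M[F]_(\dim {:g}) :=
  \matrix_(i, j) coord (vbasis {:g}) i (lie x (vbasis {:g})`_j).

Lemma ad_linear : linear ad.
Proof. by move=> a x y; apply/matrixP => i j; rewrite !mxE liePl linearP. Qed.

Lemma ad_mulE x y i j : (ad x *m ad y) i j =
  coord (vbasis {:g}) i (lie x (lie y (vbasis {:g})`_j)).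
Proof.
rewrite [lie y _ in RHS](coord_vbasis (memvf _)) lie_sumr linear_sum mxE.
by apply: eq_bigr => k _; rewrite lieZr linearZ !mxE mulrC.
Qed.

Lemma ad_lie x y : ad (lie x y) = ad x *m ad y - ad y *m ad x.
Proof.
apply/matrixP => i j; rewrite [LHS]mxE [RHS]mxE [X in _ + X]mxE !ad_mulE -linearB.
congr (coord _ _ _); set z := _`_j.
have /eqP := lie_jacobi x y z; rewrite (lie_antisym z (lie x y)) subr_eq0 => /eqP <-.
by rewrite (lie_antisym z x) -[- lie x z]scaleN1r lieZr scaleN1r.
Qed.

Lemma killing_tr x y : killing x y = \tr (ad x *m ad y).
Proof. by apply: eq_bigr => i _; rewrite ad_mulE. Qed.

(** Cyclicity of the trace. *)
Lemma killing_inv x y z : killing (lie x y) z = killing x (lie y z).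
Proof.
rewrite !killing_tr !ad_lie mulmxBl mulmxBr !linearB /= !mulmxA; congr (_ - _).
by rewrite -[in LHS]mulmxA [LHS]mxtrace_mulC.
Qed.

Context (d : nat) (b : d.-tuple g) (bon : orthonormal_basis b).

Lemma coord_exp x : x = \sum_j coord b j x *: b`_j.
Proof. by case: bon => bb _; apply: coord_basis bb (memvf x). Qed.

Lemma coord_b (i j : 'I_d) : coord b i b`_j = (i == j)%:R.
Proof. by case: bon => bb _; rewrite coord_free ?(basis_free bb) // eq_sym. Qed.

Lemma coord_comb (c : 'I_d -> F) p : coord b p (\sum_q c q *: b`_q) = c p.
Proof.
rewrite linear_sum (bigD1 p) //= linearZ /= coord_b eqxx mulr1 big1 ?addr0 // => q qp.
by rewrite linearZ /= coord_b eq_sym (negPf qp) mulr0.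
Qed.

Lemma coord_ext x y : (forall j, coord b j x = coord b j y) -> x = y.
Proof. by move=> e; rewrite [x]coord_exp [y]coord_exp; apply: eq_bigr => j _; rewrite e. Qed.

Lemma killingE x y : killing x y = \sum_p coord b p x * coord b p y.
Proof.
rewrite killing_tr [x in LHS]coord_exp [y in LHS]coord_exp.
have ad_sum (c : 'I_d -> F) : ad (\sum_j c j *: b`_j) = \sum_j c j *: ad b`_j.
  pose adl : {linear g -> _} := HB.pack ad (GRing.isLinear.Build _ _ _ _ _ ad_linear).
  rewrite -[ad _]/(adl _) linear_sum; apply: eq_bigr => j _.
  by rewrite linearZ.
rewrite !ad_sum mulmx_suml linear_sum; apply: eq_bigr => p _ /=.
rewrite mulmx_sumr linear_sum (bigD1 p) //= big1 ?addr0.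
  by rewrite -scalemxAl -scalemxAr !linearZ /= -killing_tr (proj2 bon) eqxx mulr1.
move=> q qp; rewrite -scalemxAl -scalemxAr !linearZ /= -killing_tr (proj2 bon).
by rewrite eq_sym (negPf qp) !mulr0.
Qed.

Definition struct_const (p q m : 'I_d) : F := coord b m (lie b`_p b`_q).

Lemma coord_killing x p : coord b p x = killing x b`_p.
Proof.
rewrite killingE (bigD1 p) //= big1 ?addr0 ?coord_b ?eqxx ?mulr1 // => q qp.
by rewrite coord_b (negPf qp) mulr0.
Qed.

(** Invariance of the Killing form, read in an orthonormal basis. *)
Lemma struct_const_cyclic p q m : struct_const p q m = struct_const q m p.
Proof.
rewrite /struct_const !coord_killing killing_inv killingE [RHS]killingE.
by apply: eq_bigr => i _; rewrite mulrC.
Qed.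

Lemma struct_const_anti p q m : struct_const p q m = - struct_const q p m.
Proof. by rewrite /struct_const lie_antisym linearN. Qed.

Lemma coord_lie x y m : coord b m (lie x y) =
  \sum_p \sum_q struct_const p q m * (coord b p x * coord b q y).
Proof.
rewrite [x in LHS]coord_exp lie_suml linear_sum; apply: eq_bigr => p _.
rewrite lieZl linearZ /= [y in LHS]coord_exp lie_sumr linear_sum mulr_sumr.
by apply: eq_bigr => q _; rewrite lieZr linearZ /= mulrA mulrC.
Qed.
End Killing.

(** * Subspaces and their spans *)

Section Subspaces.
Context (F : fieldType) (E : lmodType F).
Implicit Types (S T : set E) (u v : E).

Lemma lspan_subspace S : is_subspace (lspan S).
Proof.
split=> [T [[T0 _] _] //|a u v hu hv T [sT ST]].
by apply: (proj2 sT); [apply: hu|apply: hv].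
Qed.

Lemma lspan_gen S : S `<=` lspan S.
Proof. by move=> u Su T [_]; apply. Qed.

Lemma lspan_min S T : is_subspace T -> S `<=` T -> lspan S `<=` T.
Proof. by move=> sT ST u; apply. Qed.

Lemma subspace0 S : is_subspace S -> S 0. Proof. by case. Qed.
Lemma subspaceZ S a u : is_subspace S -> S u -> S (a *: u).
Proof. by move=> [V0 VD] Vu; rewrite -[_ *: _]addr0; exact: VD. Qed.
Lemma subspaceD S u v : is_subspace S -> S u -> S v -> S (u + v).
Proof. by move=> [V0 VD] Vu Vv; rewrite -[u]scale1r; exact: VD. Qed.
Lemma subspaceN S u : is_subspace S -> S u -> S (- u).
Proof. by move=> sV Vu; rewrite -scaleN1r; exact: subspaceZ. Qed.
Lemma subspaceB S u v : is_subspace S -> S u -> S v -> S (u - v).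
Proof. by move=> sV Vu Vv; apply: subspaceD => //; exact: subspaceN. Qed.
Lemma subspace_sum S (I : Type) (l : seq I) (P : pred I) (G : I -> E) :
  is_subspace S -> (forall i, S (G i)) -> S (\sum_(i <- l | P i) G i).
Proof.
by move=> sS SG; elim/big_rec: _ => [|i x _ Sx]; [exact: subspace0|exact: subspaceD].
Qed.
End Subspaces.

(** * The Manin triple: coordinates and the bilinear form *)

Section Coord.
Context (F : fieldType) (n : nat) (g : lieAlgType F).
Context (d : nat) (b : d.-tuple g) (bon : orthonormal_basis b).
Implicit Types u v w : adj n g.
Notation co := (@lcoord F n d g b F).

Lemma lcoord_inj u v : (forall j, co j u = co j v) -> u = v.
Proof.
move=> e; apply: injective_projections.
  apply: laurentP => k; apply: (coord_ext bon) => j.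
  exact: (congr1 (fun w : adj n F => w.1 k) (e j)).
apply: truncP => k; apply: (coord_ext bon) => j.
have := congr1 (fun w : adj n F => tcoef w.2 k) (e j).
by rewrite !tmapE.
Qed.

Lemma lcoordD j u v : co j (u + v) = co j u + co j v.
Proof. by apply: adj_mapD => x y; rewrite /coef_in linearD ascalD. Qed.

Lemma lcoord0 j : co j 0 = 0.
Proof. by apply: (@addrI _ (co j 0)); rewrite -lcoordD !addr0. Qed.

Lemma lcoordN j u : co j (- u) = - co j u.
Proof. by apply: (@addrI _ (co j u)); rewrite -lcoordD !subrr lcoord0. Qed.

Lemma lcoordZ j a u : co j (a *: u) = ascal a * co j u.
Proof.
congr pair.
  by apply: laurentP => k; rewrite [RHS]lmul_mono0l /= /coef_in linearZ.
apply: truncP => k; rewrite [RHS]tconst_mul !tmapE ?tcoefZ.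
by rewrite /coef_in linearZ.
Qed.

Lemma lcoord_sum j (I : Type) (r : seq I) (P : pred I) (G : I -> adj n g) :
  co j (\sum_(i <- r | P i) G i) = \sum_(i <- r | P i) co j (G i).
Proof. exact: (big_morph (co j) (lcoordD j) (lcoord0 j)). Qed.

Lemma lcoord_diag j c : co j (diag n c) = diag n (fun k => coord b j (c k)).
Proof. by rewrite /lcoord adj_map_diag. Qed.

Lemma lcoord_ascal j a (p0 : a * coord b j 0 = 0) u :
  adj_map (phi := fun x => a * coord b j x) p0 u = ascal a * co j u.
Proof.
congr pair; first by apply: laurentP => k; rewrite [RHS]lmul_mono0l.
by apply: truncP => k; rewrite [RHS]tconst_mul !tmapE ?tcoefZ.
Qed.

Lemma lcoord_lie m u v : co m (adj_lie u v) =
  \sum_p \sum_q ascal (struct_const b p q m) * (co p u * co q v).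
Proof.
rewrite pair_big /= /adj_lie /lcoord.
have ph0 (i : 'I_d * 'I_d) : struct_const b i.1 i.2 m * coord b i.1 0 = 0.
  by rewrite linear0 mulr0.
rewrite (@adj_conv_coord n g g g F (@lie F g) _ _ (coef_in b F m) _ _ _
  (fun i x => struct_const b i.1 i.2 m * coord b i.1 x)
  (fun i y => coord b i.2 y) ph0 (fun i => coef_in0 b F i.2)).
- by apply: eq_bigr => i _; rewrite lcoord_ascal mulrA.
- by move=> x y; rewrite /coef_in linearD ascalD.
- move=> x y; rewrite [LHS](coord_lie bon) pair_big /=.
  by apply: eq_bigr => i _; rewrite mulrA.
Qed.

Lemma lcoord_smul j s u : co j (adj_smul s u) = diag n (s : nat -> F) * co j u.
Proof.
have id0 (i : 'I_1) : (fun x : F => x) 0 = 0 by [].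
rewrite /adj_smul /lcoord.
rewrite (@adj_conv_coord n F g g F _ _ _ (coef_in b F j) _ _ _
  (fun _ x => x) (fun _ y => coord b j y) id0 (fun _ => coef_in0 b F j)).
- rewrite big_ord1; congr (_ * _).
  rewrite adj_map_diag //.
- by move=> x y; rewrite /coef_in linearD ascalD.
- by move=> x y; rewrite big_ord1 /coef_in linearZ.
Qed.

Context (alpha : int -> F).
Notation t := (@res_form F n alpha).
Notation B := (bilform alpha).

Lemma bilformE u v : B u v = t (\sum_p co p u * co p v).
Proof.
rewrite /bilform.
have id0 : (fun x : F => x) 0 = 0 by [].
rewrite -[adj_conv _ _ u v](adj_map_id id0).
rewrite (@adj_conv_coord n g g F F _ _ _ _ _ _ _
  (fun i x => coord b i x) (fun i y => coord b i y)
  (fun i => coef_in0 b F i) (fun i => coef_in0 b F i)) //.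
exact: (killingE bon).
Qed.

Lemma bilformC u v : B u v = B v u.
Proof. by rewrite !bilformE; congr (t _); apply: eq_bigr => p _; rewrite adjF_mulC. Qed.

Lemma bilformDl u v w : B (u + v) w = B u w + B v w.
Proof.
rewrite !bilformE -res_formD -big_split; congr (t _); apply: eq_bigr => p _.
by rewrite lcoordD mulrDl.
Qed.

Lemma bilformZl a u w : B (a *: u) w = a * B u w.
Proof.
rewrite !bilformE -res_formZ mulr_sumr; congr (t _); apply: eq_bigr => p _.
by rewrite lcoordZ mulrA.
Qed.

Lemma res_form_scal_mull a (x y z : adj n F) :
  t (ascal a * (x * y) * z) = a * t (x * y * z).
Proof. by rewrite -res_formZ; congr (t _); exact/esym/mulrA. Qed.

Lemma res_form_scal_mulr a (x y z : adj n F) :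
  t (x * (ascal a * (y * z))) = a * t (x * y * z).
Proof.
rewrite -res_formZ; congr (t _).
by rewrite [LHS]mulrA (adjF_mulC x) -[LHS]mulrA; congr (_ * _); exact: mulrA.
Qed.

(** The coordinates of a bracket have cyclically symmetric structure constants, and
    the coordinates themselves commute. *)
Lemma bilform_inv u v w : B (adj_lie u v) w = B u (adj_lie v w).
Proof.
rewrite !bilformE !res_form_sum.
transitivity (\sum_p \sum_q \sum_m struct_const b p q m * t (co p u * co q v * co m w)).
  under eq_bigr do rewrite lcoord_lie mulr_suml res_form_sum.
  rewrite exchange_big; apply: eq_bigr => p _ /=.
  under eq_bigr do rewrite mulr_suml res_form_sum.
  rewrite exchange_big; apply: eq_bigr => q _ /=; apply: eq_bigr => m _.
  exact: res_form_scal_mull.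
apply: eq_bigr => p _; rewrite lcoord_lie mulr_sumr res_form_sum; apply: eq_bigr => q _.
rewrite mulr_sumr res_form_sum; apply: eq_bigr => m _.
rewrite (struct_const_cyclic bon); exact/esym/res_form_scal_mulr.
Qed.

Lemma adj_lieC u v : adj_lie u v = - adj_lie v u.
Proof.
apply: lcoord_inj => m; rewrite lcoordN !lcoord_lie exchange_big -sumrN; apply: eq_bigr => q _.
rewrite -sumrN; apply: eq_bigr => p _; rewrite [co p u * _]adjF_mulC -mulNr struct_const_anti.
congr (_ * _); apply: (@addrI _ (ascal (struct_const b q p m))).
by rewrite -ascalD !subrr ascal0.
Qed.
Context (s : nat -> F).
Context (s_def : lser s * (lmono n%:Z 1 * alpha_ser n alpha) = 1).
Implicit Types (r : series n d g) (V : set (adj n g)) (f : adj n g -> F).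
Notation sw k i := (adj_smul s (wbase n b k i)).

Lemma bilformDr u v w : B w (u + v) = B w u + B w v.
Proof. by rewrite bilformC bilformDl !(bilformC w). Qed.

Lemma bilformZr a u w : B w (a *: u) = a * B w u.
Proof. by rewrite bilformC bilformZl (bilformC w). Qed.

Lemma bilform0r w : B w 0 = 0.
Proof. by rewrite -(scale0r (0 : adj n g)) bilformZr mul0r. Qed.

Lemma bilformNr u w : B w (- u) = - B w u.
Proof. by rewrite -scaleN1r bilformZr mulN1r. Qed.

Lemma bilformNl u w : B (- u) w = - B u w.
Proof. by rewrite ![B _ w]bilformC bilformNr. Qed.

Lemma bilform_sumr (I : Type) (l : seq I) (P : pred I) (G : I -> adj n g) w :
  B w (\sum_(i <- l | P i) G i) = \sum_(i <- l | P i) B w (G i).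
Proof. by apply: (big_morph (B w)) => [x y|]; [exact: bilformDr|exact: bilform0r]. Qed.

Lemma bilform_suml (I : Type) (l : seq I) (P : pred I) (G : I -> adj n g) w :
  B (\sum_(i <- l | P i) G i) w = \sum_(i <- l | P i) B (G i) w.
Proof.
by rewrite bilformC bilform_sumr; apply: eq_bigr => i _; rewrite bilformC.
Qed.

Lemma bilform_perp_subspace u : is_subspace [set v | B u v = 0].
Proof.
split=> [|a x y /= hx hy] /=; first exact: bilform0r.
by rewrite bilformDr bilformZr hx hy mulr0 addr0.
Qed.

Lemma lcoord_wbase j k i : co j (wbase n b k i) = if i == j then wscalar F n k else 0.
Proof.
have cb : coord b j b`_i = if i == j then 1 else 0.
  by rewrite (coord_b bon) eq_sym; case: eqP.
rewrite /wbase /wscalar; case: ltnP => kn.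
  transitivity (- co j (0, tmake n (fun m => if m == (n - 1 - k)%N then b`_i else 0))).
    rewrite -lcoordN; congr (lcoord _ _ _ _).
    by apply: injective_projections; rewrite /= ?oppr0.
  have -> : co j (0, tmake n (fun m => if m == (n - 1 - k)%N then b`_i else 0)) =
     (0, tmake n (fun m => if m == (n - 1 - k)%N then if i == j then 1 else 0 else 0)).
    congr pair; first by apply: laurentP => m; exact: coef_in0.
    apply: truncP => m; rewrite tmapE !tcoefE /coef_in.
    by case: ifP => _; rewrite ?cb // linear0.
  case: eqP => _; first by apply: injective_projections; rewrite /= ?oppr0.
  have -> : tmake n (fun m => if m == (n - 1 - k)%N then 0 else 0) = 0 :> trunc n F.
    by apply: truncP => m; rewrite tcoefE if_same /tcoef ffunE.
  by rewrite -[RHS]oppr0.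
have -> : co j (lmono (n%:Z - 1 - k%:Z) b`_i, 0) =
    (lmono (n%:Z - 1 - k%:Z) (if i == j then 1 else 0), 0).
  congr pair; last first.
    apply: truncP => m; rewrite tmapE -[tcoef 0 m]/(tcoef (0 : trunc n g) m).
    by rewrite /tcoef ffunE coef_in0 ffunE.
  apply: laurentP => m; rewrite /= /coef_in.
  by case: ifP => _; rewrite ?cb // linear0.
case: eqP => // _; congr pair; apply: laurentP => m.
by rewrite /= if_same.
Qed.

Lemma lcoord_sw j k i : co j (sw k i) = if i == j then diag n s * wscalar F n k else 0.
Proof. by rewrite lcoord_smul lcoord_wbase; case: ifP; rewrite ?mulr0. Qed.

Lemma bilform_sw k i u : B (sw k i) u = t (diag n s * wscalar F n k * co i u).
Proof.
rewrite bilformE (bigD1 i) //= lcoord_sw eqxx big1 ?addr0 // => j ji.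
by rewrite lcoord_sw eq_sym (negPf ji) mul0r.
Qed.

Lemma bilform_sw_diag k i c : B (sw k i) (diag n c) = coord b i (c k).
Proof. by rewrite bilform_sw lcoord_diag (res_form_w_diag s_def). Qed.

Lemma bilform_sw_sw k i l j : B (sw k i) (sw l j) = if i == j then quot_coef n s l k else 0.
Proof.
rewrite bilform_sw lcoord_sw eq_sym; case: ifP => _; first exact: (res_form_ww s_def).
by rewrite mulr0 res_form0.
Qed.

Lemma bilform_diag (c e : nat -> g) : B (diag n c) (diag n e) = 0.
Proof.
rewrite bilformE res_form_sum big1 // => p _.
by rewrite !lcoord_diag diag_mul res_form_diag.
Qed.

Definition gmono (l : nat) (i : 'I_d) : nat -> g := fun m => if m == l then b`_i else 0.

Lemma bilform_gmono u l i : B u (diag n (gmono l i)) = t (co i u * diag n (psdelta F l)).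
Proof.
have cb j : co j (diag n (gmono l i)) = if i == j then diag n (psdelta F l) else 0.
  rewrite lcoord_diag; case: eqP => [<-|/eqP ij].
    congr (diag n _); apply/funext => m; rewrite /gmono /psdelta.
    by case: ifP; rewrite ?linear0 // (coord_b bon) eqxx.
  rewrite -[RHS]diag0; congr (diag n _); apply/funext => m; rewrite /gmono.
  by case: ifP => _; rewrite ?linear0 // (coord_b bon) eq_sym (negPf ij).
rewrite bilformE (bigD1 i) //= cb eqxx big1 ?addr0 // => j ji.
by rewrite cb eq_sym (negPf ji) mulr0.
Qed.

(** Coordinate by coordinate this is [res_form_perp]; with [bilform_diag] it makes Delta
    Lagrangian. *)
Lemma diag_perp u : (forall l i, B u (diag n (gmono l i)) = 0) -> diag_set u.
Proof.
move=> h; have c i : {c | co i u = diag n c}.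
  by apply: cid; apply: (res_form_perp s_def) => l; rewrite -bilform_gmono.
exists (fun k => \sum_i projT1 (c i) k *: b`_i) => //.
apply: lcoord_inj => j; rewrite lcoord_diag (projT2 (c j)); congr (diag n _).
by apply/funext => k; rewrite (coord_comb bon).
Qed.

Lemma bilform_gmono_fin u : exists N, forall l i, (N <= l)%N -> B u (diag n (gmono l i)) = 0.
Proof.
have N i : {N | forall l, (N <= l)%N -> t (co i u * diag n (psdelta F l)) = 0}.
  by apply: cid; exact: res_form_fin.
exists (\max_i projT1 (N i)) => l i Nl; rewrite bilform_gmono (projT2 (N i)) //.
by apply: leq_trans Nl; exact: leq_bigmax.
Qed.

Lemma diag_subspace : is_subspace (@diag_set F n g).
Proof.
split; first by exists (fun _ => 0) => //; exact: diag0.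
move=> a u v [c _ <-] [e _ <-]; exists (fun k => a *: c k + e k) => //.
rewrite -diagD; congr (_ + _); congr pair.
  by apply: laurentP => -[k|k]; rewrite lcoefZ //= scaler0.
by apply: truncP => i; rewrite tcoefZ !tcoefE.
Qed.

Lemma wspan_subspace r : is_subspace (wspan r). Proof. exact: lspan_subspace. Qed.
Lemma wspan_gen r k i : wspan r (r k i).
Proof. by apply: lspan_gen; exists k => //; exists i. Qed.
Lemma wspan_min r V : is_subspace V -> (forall k i, V (r k i)) -> wspan r `<=` V.
Proof. by move=> sV Vr; apply: lspan_min => // _ [k _ [i _ <-]]. Qed.

(** * The subspace of a series *)

(** Together with [diag_ns_type], this describes (n, s)-type series as the families
    that represent s w_(k, i) modulo Delta. *)
Lemma ns_type_diag r : ns_type b s r -> forall k i, diag_set (r k i - sw k i).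
Proof.
move=> [G ->] k i; exists (fun l => \sum_(j < d) G l k j i *: b`_j) => //.
by rewrite /ns_series addrC addKr.
Qed.

Lemma diag_ns_type r : (forall k i, diag_set (r k i - sw k i)) -> ns_type b s r.
Proof.
move=> h; have c k i : {c | diag n c = r k i - sw k i}.
  by apply: cid; have [c _ e] := h k i; exists c.
exists (fun l k => \matrix_(j, i) coord b j (projT1 (c k i) l)).
apply/funext => k; apply/funext => i; rewrite /ns_series /power_part addrC.
apply: (canRL (subrK _)); rewrite -(projT2 (c k i)); congr (diag n _).
by apply/funext => l; rewrite [LHS](coord_exp bon); apply: eq_bigr => j _; rewrite mxE.
Qed.

Lemma bilform_ns r : ns_type b s r ->
  forall k i c, B (r k i) (diag n c) = coord b i (c k).
Proof.
move=> hr k i c; have [e _ re] := ns_type_diag hr k i.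
by rewrite -[r k i](subrK (sw k i)) -re bilformDl bilform_diag add0r bilform_sw_diag.
Qed.

Lemma bilform_ns_gmono r : ns_type b s r ->
  forall k i l j, B (r k i) (diag n (gmono l j)) = if (k == l) && (i == j) then 1 else 0.
Proof.
move=> hr k i l j; rewrite (bilform_ns hr) /gmono.
case: (k == l) => /=; last by rewrite linear0.
by rewrite (coord_b bon); case: eqP.
Qed.

(** For f linear this is the element of Delta that represents f o P, where P is the
    projection to W(r) along Delta. *)
Definition dual_diag r (f : adj n g -> F) : adj n g :=
  diag n (fun l => \sum_i f (r l i) *: b`_i).

Lemma scalar_form0 f : scalar f -> f 0 = 0.
Proof.
move=> fl; have := fl 1 0 0; rewrite scaler0 addr0 mul1r => /eqP.
by rewrite -subr_eq0 opprD addNKr oppr_eq0 => /eqP.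
Qed.

Lemma dual_diagE r f : ns_type b s r -> scalar f ->
  forall y, wspan r y -> B (dual_diag r f) y = f y.
Proof.
move=> hr fl; apply: (@wspan_min r [set y | B (dual_diag r f) y = f y]).
  split=> [|a u v /= hu hv] /=; first by rewrite bilform0r scalar_form0.
  by rewrite bilformDr bilformZr hu hv fl.
by move=> k i /=; rewrite bilformC (bilform_ns hr) (coord_comb bon).
Qed.

(** These linear forms, indexed by int + 'I_n, separate the points of A(n, alpha). *)
Definition adj_coef (x : int + 'I_n) (u : adj n F) : F :=
  match x with inl k => u.1 k | inr i => tcoef u.2 i end.

Lemma adj_coef_inj u v : (forall x m, adj_coef x (co m u) = adj_coef x (co m v)) -> u = v.
Proof.
move=> e; apply: lcoord_inj => m; apply: injective_projections.
  by apply: laurentP => k; exact: (e (inl k) m).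
by apply: truncP => k; exact: (e (inr k) m).
Qed.

Lemma adj_coefD x (u v : adj n F) : adj_coef x (u + v) = adj_coef x u + adj_coef x v.
Proof. by case: x => k //=; rewrite tcoefD. Qed.

Lemma adj_coef_ascal x a (u : adj n F) : adj_coef x (ascal a * u) = a * adj_coef x u.
Proof. by case: u x => f p [k|k] /=; [rewrite [LHS]lmul_mono0l|rewrite [LHS]tconst_mul]. Qed.

Lemma adj_coef_lin x m : scalar (fun u => adj_coef x (co m u)).
Proof. by move=> a u v; rewrite lcoordD lcoordZ adj_coefD adj_coef_ascal. Qed.

(** A linear form f agrees on W(r) with B (D_f, .), which vanishes on Delta; so every f
    vanishes on the intersection. *)
Lemma wspan_diag0 r : ns_type b s r -> forall y, diag_set y -> wspan r y -> y = 0.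
Proof.
move=> hr _ [c _ <-] wy; apply: adj_coef_inj => x m.
pose f u := adj_coef x (co m u); have fl : scalar f := adj_coef_lin x m.
by rewrite -[LHS]/(f _) -[RHS]/(f _) (scalar_form0 fl) -(dual_diagE hr fl wy) bilform_diag.
Qed.

(** Subtract from u the sum of the B (u, b_i x^l) r_(l, i), which is finite: by duality
    the difference is orthogonal to all b_i x^l, so it lies in Delta. *)
Lemma wspan_compl r : ns_type b s r -> complementary (@diag_set F n g) (wspan r).
Proof.
move=> hr; split; last by move=> y [dy wy]; apply: (wspan_diag0 hr).
move=> u; have [N hN] := bilform_gmono_fin u.
pose y := \sum_(l < N) \sum_i B u (diag n (gmono l i)) *: r l i.
exists (u - y), y; split; last by rewrite subrK.
  apply: diag_perp => l j; rewrite bilformDl bilformNl bilform_suml.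
  under eq_bigr do rewrite bilform_suml.
  under eq_bigr do under eq_bigr do rewrite bilformZl (bilform_ns_gmono hr).
  have [lN|Nl] := ltnP l N.
    rewrite (bigD1 (Ordinal lN)) //= (bigD1 j) //= !eqxx mulr1 big1 ?addr0.
      rewrite big1 ?addr0 ?subrr // => i; rewrite -val_eqE /= => /negPf il.
      by apply: big1 => p _; rewrite il mulr0.
    by move=> i /negPf ij; rewrite ij mulr0.
  rewrite hN // big1 ?subrr // => i _; apply: big1 => p _.
  by rewrite ltn_eqF ?mulr0 //; apply: leq_trans (ltn_ord i) Nl.
apply: (@subspace_sum _ _ (wspan r)) => [|l]; first exact: wspan_subspace.
apply: (@subspace_sum _ _ (wspan r)) => [|i]; first exact: wspan_subspace.
by apply: (@subspaceZ _ _ (wspan r)); [exact: wspan_subspace|exact: wspan_gen].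
Qed.

Lemma compl_eq V W : is_subspace V -> is_subspace W ->
  complementary (@diag_set F n g) V -> complementary (@diag_set F n g) W ->
  V `<=` W -> V = W.
Proof.
move=> sV sW [hV _] [_ hW] VW; apply/seteqP; split=> // w Ww.
have [x [y [dx Vy e]]] := hV w.
suff -> : w = y by [].
rewrite e; have -> : x = 0; last by rewrite add0r.
apply: hW; split=> //; have -> : x = w - y by rewrite e addrK.
by apply: (@subspaceB _ _ W) => //; apply: VW.
Qed.

(** Take for r_(k, i) the component in V of s w_(k, i); then W(r) is a complement of
    Delta contained in V, hence equal to V. *)
Lemma ns_type_exists V : is_subspace V -> complementary (@diag_set F n g) V ->
  exists2 r, ns_type b s r & wspan r = V.
Proof.
move=> sV cV; have p k i : {y | V y /\ diag_set (y - sw k i)}.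
  apply: cid; have [x [y [dx Vy e]]] := proj1 cV (sw k i).
  exists y; split=> //; rewrite e opprD addrC subrK.
  exact: (@subspaceN _ _ (@diag_set F n g) x diag_subspace dx).
have hr : ns_type b s (fun k i => projT1 (p k i)).
  by apply: diag_ns_type => k i; case: (projT2 (p k i)).
exists (fun k i => projT1 (p k i)) => //.
apply: (compl_eq (wspan_subspace _) sV (wspan_compl hr) cV).
by apply: (wspan_min sV) => k i; case: (projT2 (p k i)).
Qed.

Lemma ns_type_diagB r r' k i : ns_type b s r -> ns_type b s r' ->
  diag_set (r k i - r' k i).
Proof.
move=> hr hr'; have -> : r k i - r' k i = (r k i - sw k i) - (r' k i - sw k i).
  by rewrite opprB addrA subrK.
apply: (@subspaceB _ _ (@diag_set F n g)); first exact: diag_subspace.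
  exact: ns_type_diag.
exact: ns_type_diag.
Qed.

Lemma wspan_inj r r' : ns_type b s r -> ns_type b s r' -> wspan r = wspan r' -> r = r'.
Proof.
move=> hr hr' e; apply/funext => k; apply/funext => i; apply/eqP; rewrite -subr_eq0.
apply/eqP; apply: (wspan_diag0 hr); first exact: ns_type_diagB.
apply: (@subspaceB _ _ (wspan r)); [exact: wspan_subspace|exact: wspan_gen|].
by rewrite e; exact: wspan_gen.
Qed.

(** An element orthogonal to Delta lies in Delta, and the r_(k, i) read off its
    coefficients. *)
Lemma bilform_nondeg r u : ns_type b s r ->
  (forall c, B u (diag n c) = 0) -> (forall k i, B u (r k i) = 0) -> u = 0.
Proof.
move=> hr hd hw; have [|c _ cu] := @diag_perp u; first by move=> l i; exact: hd.
rewrite -cu -[RHS]diag0; congr (diag n _); apply/funext => k; apply: (coord_ext bon) => i.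
by rewrite linear0 -(bilform_ns hr) bilformC cu.
Qed.

(** * Skew-symmetric series and Lagrangian subspaces *)

Lemma regular_partE G l k : regular_part b s (ns_series n b s G) l k = G l k.
Proof.
apply/matrixP => j i; rewrite mxE /ns_series [_ + power_part _ _ _ _ _]addrC addrK /=.
by rewrite (coord_comb bon).
Qed.

(** The pairing of the singular parts is the quotient of s(x) y^n - s(y) x^n by x - y,
    the regular part of r contributes g, and that of rbar, which is -tau(g(y, x)) minus
    this quotient, cancels both.  Thus W(rbar) is orthogonal to W(r) for any r. *)
Lemma bilform_bar r : ns_type b s r ->
  forall k i l j, B (ns_bar b s r k i) (r l j) = 0.
Proof.
move=> [G ->] k i l j; rewrite /ns_bar {1 2}/ns_series.
rewrite bilformDl !bilformDr [B (power_part _ _ _ _ _) (sw _ _)]bilformC.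
rewrite bilform_diag addr0 bilform_sw_sw !bilform_sw_diag.
rewrite !(coord_comb bon) regular_partE !mxE [j == i]eq_sym.
case: eqP => _; rewrite ?mulr1n ?mulr0n ?oppr0 ?add0r ?subrr //.
by rewrite addrACA subrr add0r subrr.
Qed.

Lemma ns_bar_type r : ns_type b s (ns_bar b s r).
Proof. by eexists; reflexivity. Qed.

(** An isotropic complement of Delta is Lagrangian because Delta is isotropic and B is
    nondegenerate; conversely r - rbar has coefficients in Delta and, by
    [bilform_bar], in the orthogonal of W(r). *)
Lemma skew_lagrangian r : ns_type b s r ->
  skew_symmetric b s r <-> lagrangian alpha (wspan r).
Proof.
move=> hr; split=> [sk|lag].
  have iso : forall u v, wspan r u -> wspan r v -> B u v = 0.
    move=> u v wu; move: v; apply: (wspan_min (bilform_perp_subspace u)) => l j /=.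
    rewrite bilformC; move: u wu; apply: (wspan_min (bilform_perp_subspace _)) => k i /=.
    by rewrite sk -{2}sk bilform_bar.
  apply/seteqP; split=> [u wu v wv /=|u /= hu]; first exact: iso.
  have [x [y [[c _ cx] wy e]]] := proj1 (wspan_compl hr) u.
  suff x0 : x = 0 by rewrite e x0 add0r.
  apply: (bilform_nondeg hr) => [c'|k i]; first by rewrite -cx bilform_diag.
  have -> : x = u - y by rewrite e addrK.
  rewrite bilformDl bilformNl hu ?iso ?subrr //; exact: wspan_gen.
apply/funext => k; apply/funext => i; apply/eqP; rewrite -subr_eq0; apply/eqP.
apply: (wspan_diag0 hr).
  by apply: ns_type_diagB => //; exact: ns_bar_type.
apply: (@subspaceB _ _ (wspan r)); [exact: wspan_subspace|exact: wspan_gen|].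
rewrite lag /=; apply: (wspan_min (bilform_perp_subspace _)) => l j.
exact: bilform_bar.
Qed.

(** * The GCYB defect and Lie subalgebras *)

Lemma adj_lieZDl a u v w : adj_lie (a *: u + v) w = a *: adj_lie u w + adj_lie v w.
Proof.
apply: lcoord_inj => m; rewrite lcoordD lcoordZ !lcoord_lie mulr_sumr -big_split.
apply: eq_bigr => p _.
rewrite mulr_sumr -big_split; apply: eq_bigr => q _ /=.
rewrite lcoordD lcoordZ mulrDl mulrDr -mulrA; congr (_ + _).
by rewrite !mulrA (adjF_mulC (ascal a)).
Qed.

Lemma scalar_formN f u : scalar f -> f (- u) = - f u.
Proof. by move=> fl; rewrite -scaleN1r -[_ *: _]addr0 fl (scalar_form0 fl) addr0 mulN1r. Qed.

Lemma adj_lie_diag (c e : nat -> g) : adj_lie (diag n c) (diag n e) =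
  diag n (fun k => \sum_(p < k.+1) lie (c p) (e (k - p)%N)).
Proof.
apply: lcoord_inj => m; rewrite lcoord_lie lcoord_diag.
under eq_bigr do under eq_bigr do rewrite !lcoord_diag diag_mul ascal_adj_const adj_const_mul.
under eq_bigr do rewrite diag_sum; rewrite diag_sum; congr (diag n _); apply/funext => k.
rewrite linear_sum [RHS]/=; under [RHS]eq_bigr do rewrite (coord_lie bon).
rewrite [RHS]exchange_big; apply: eq_bigr => p _ /=.
rewrite [RHS]exchange_big; apply: eq_bigr => q _ /=.
by rewrite mulr_sumr.
Qed.

(** The coefficient of b_c x_3^k in GCYB(r), after applying f to the first tensor
    factor; the three summands come from the three commutators. *)
Definition defect r f k c : adj n g :=
  dual_diag r (fun v => f (adj_lie v (r k c))) + adj_lie (dual_diag r f) (r k c) +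
  \sum_(p < k.+1) \sum_a \sum_e (f (r p a) * struct_const b a e c) *: ns_bar b s r (k - p)%N e.

(** The first summand lies in the isotropic Delta.  For the second, invariance and
    duality leave the coefficient of b_c x^k in [e, D_f], and the third
    gives the same coefficient of [D_f, e]. *)
Lemma bilform_defect_diag r f k c e : ns_type b s r -> B (defect r f k c) (diag n e) = 0.
Proof.
move=> hr; rewrite /defect !bilformDl bilform_diag add0r adj_lieC bilformNl bilform_inv.
rewrite adj_lie_diag (bilform_ns hr) linear_sum addrC; apply/eqP; rewrite subr_eq0; apply/eqP.
rewrite bilform_suml; apply: eq_bigr => p _; rewrite bilform_suml /= (coord_lie bon).
apply: eq_bigr => a _; rewrite bilform_suml; apply: eq_bigr => q _.
rewrite bilformZl (bilform_ns (ns_bar_type r)) (coord_comb bon).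
by rewrite mulrA [_ * f _]mulrC.
Qed.

(** The third summand of the defect is a combination of coefficients of rbar, so it is
    orthogonal to W(r); the first two are evaluated with [dual_diagE] and invariance. *)
Lemma bilform_defect_wspan r f k c v : ns_type b s r -> scalar f -> wspan r v ->
  B (defect r f k c) v = f (adj_lie v (r k c)) + B (dual_diag r f) (adj_lie (r k c) v).
Proof.
move=> hr fl wv; rewrite /defect !bilformDl bilform_inv (dual_diagE hr) //; last first.
  by move=> a u w; rewrite adj_lieZDl fl.
rewrite -[RHS]addr0; congr (_ + _); rewrite bilform_suml big1 // => p _.
rewrite bilform_suml big1 // => a _; rewrite bilform_suml big1 // => e _.
rewrite bilformZl; apply/eqP; rewrite mulf_eq0; apply/orP; right; apply/eqP.
by move: v wv; apply: (wspan_min (bilform_perp_subspace _)) => l j; exact: bilform_bar.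
Qed.

(** Let h = r_(k, c), and let P be the projection to W(r) along Delta.  The defect pairs
    with v in W(r) to f ([v, h] + P [h, v]), and with Delta to zero.  So it is zero for
    all f if and only if [v, h] = P [v, h] for all v in W(r). *)
Lemma subalgebra_defect r : ns_type b s r ->
  (is_subalgebra (wspan r) <->
   forall x m k c, defect r (fun u => adj_coef x (co m u)) k c = 0).
Proof.
move=> hr; split=> [[_ hW] x m k c|h].
  (* For v = r_(l, j) and h = r_(k, c), [h, v] is in W(r), so the defect pairs with v
     to f ([v, h]) + f ([h, v]) = 0. *)
  pose f u := adj_coef x (co m u); have fl : scalar f := adj_coef_lin x m.
  apply: (bilform_nondeg hr) => [e|l j]; first exact: bilform_defect_diag.
  rewrite (bilform_defect_wspan k c hr fl) ?(dual_diagE hr fl) //; try exact: wspan_gen.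
    by rewrite adj_lieC (scalar_formN _ fl) addNr.
  by apply: hW; exact: wspan_gen.
have gen k c l j : wspan r (adj_lie (r l j) (r k c)).
  have [x [y [[e _ ex] wy xy]]] := proj1 (wspan_compl hr) (adj_lie (r k c) (r l j)).
  (* With v = r_(l, j) and h = r_(k, c), y = P [h, v], and the pairing of the defect
     with v is f ([v, h] + y). *)
  suff -> : adj_lie (r l j) (r k c) = - y.
    by apply: (@subspaceN _ _ (wspan r)); [exact: wspan_subspace|].
  apply: adj_coef_inj => z m.
  pose f u := adj_coef z (co m u); have fl : scalar f := adj_coef_lin z m.
  have := bilform_defect_wspan k c hr fl (wspan_gen (r := r) l j).
  rewrite [defect _ _ _ _]h bilformC bilform0r xy bilformDr -ex bilform_diag add0r.
  rewrite (dual_diagE hr fl wy) => /esym/eqP; rewrite addr_eq0 => /eqP fy.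
  by rewrite -[LHS]/(f _) fy -[RHS]/(f _) (scalar_formN _ fl).
split; first exact: wspan_subspace.
have linl v : is_subspace [set u | wspan r (adj_lie u v)].
  split=> [|a x y /= hx hy] /=.
    have := adj_lieZDl (-1) 0 0 v; rewrite scaler0 addr0 scaleN1r addNr => ->.
    exact: (proj1 (wspan_subspace r)).
  by rewrite adj_lieZDl; apply: (proj2 (wspan_subspace r)).
have W1 u k c : wspan r u -> wspan r (adj_lie u (r k c)).
  by move: u; apply: (wspan_min (linl (r k c))) => l j; exact: gen.
move=> u v wu wv; rewrite adj_lieC; apply: (@subspaceN _ _ (wspan r)); first exact: wspan_subspace.
move: v wv; apply: (wspan_min (linl u)) => k i /=.
rewrite adj_lieC; apply: (@subspaceN _ _ (wspan r)); first exact: wspan_subspace.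
exact: W1.
Qed.
End Coord.

(** * Tensor products, and the adjoint representation of three tensor factors *)

Definition alg_hom (F : fieldType) (A B : pzAlgType F) (f : A -> B) : Prop :=
  [/\ forall a, f (ascal a) = ascal a, {morph f : x y / x + y}
    & {morph f : x y / x * y}].

Lemma alg_hom0 (F : fieldType) (A B : pzAlgType F) (f : A -> B) : alg_hom f -> f 0 = 0.
Proof. by case=> fa _ _; rewrite -(ascal0 A) fa ascal0. Qed.

Section TensorAlgebra.
Context (F : fieldType) (A B : pzAlgType F).
Implicit Types (x : A) (y : B).
Notation T := (tens A B).

Definition inL x : T := tcl (@tens_rel F A B) (Tgen F (inl x)).
Definition inR y : T := tcl (@tens_rel F A B) (Tgen F (inr y)).

Lemma inL_hom : alg_hom inL.
Proof.
split=> [a|x x'|x x'].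
- by apply/tcl_eq/teq_rel/tensl_scal.
- by rewrite /inL /GRing.add /= padd_tcl; apply/tcl_eq/teq_rel/tensl_add.
- by rewrite /inL /GRing.mul /= pmul_tcl; apply/tcl_eq/teq_rel/tensl_mul.
Qed.

Lemma inR_hom : alg_hom inR.
Proof.
split=> [a|x x'|x x'].
- by apply/tcl_eq/teq_rel/tensr_scal.
- by rewrite /inR /GRing.add /= padd_tcl; apply/tcl_eq/teq_rel/tensr_add.
- by rewrite /inR /GRing.mul /= pmul_tcl; apply/tcl_eq/teq_rel/tensr_mul.
Qed.

Lemma in_comm x y : inL x * inR y = inR y * inL x.
Proof. by rewrite /inL /inR /GRing.mul /= !pmul_tcl; apply/tcl_eq/teq_rel/tens_comm. Qed.

Lemma tensorE x y : tensor x y = inL x * inR y. Proof. by []. Qed.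

Lemma tensorM x y x' y' : tensor x y * tensor x' y' = tensor (x * x') (y * y').
Proof.
have [_ _ lM] := inL_hom; have [_ _ rM] := inR_hom.
by rewrite !tensorE lM rM -mulrA [inR y * _]mulrA -in_comm !mulrA.
Qed.

Lemma tensorDl x x' y : tensor (x + x') y = tensor x y + tensor x' y.
Proof. by have [_ lD _] := inL_hom; rewrite !tensorE lD mulrDl. Qed.

Lemma tensorDr x y y' : tensor x (y + y') = tensor x y + tensor x y'.
Proof. by have [_ rD _] := inR_hom; rewrite !tensorE rD mulrDr. Qed.

Lemma tensorZ a x y : tensor (ascal a * x) y = tensor x (ascal a * y).
Proof.
have [la _ lM] := inL_hom; have [ra _ rM] := inR_hom.
by rewrite !tensorE lM rM la ra mulrA ascalC.
Qed.

Lemma tensor0l y : tensor (0 : A) y = 0.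
Proof. by rewrite tensorE (alg_hom0 inL_hom) mul0r. Qed.

Lemma tensor0r x : tensor x (0 : B) = 0.
Proof. by rewrite tensorE (alg_hom0 inR_hom) mulr0. Qed.

Context (D : pzAlgType F) (f : A -> D) (h : B -> D).
Hypotheses (fh : alg_hom f) (hh : alg_hom h) (fhC : forall x y, f x * h y = h y * f x).

(** The universal property: two homomorphisms with commuting images. *)
Definition tens_lift : T -> D :=
  presented_lift (fun z => match z with inl x => f x | inr y => h y end).

Let lift_rel t u : @tens_rel F A B t u ->
  teval (fun z => match z with inl x => f x | inr y => h y end) t =
  teval (fun z => match z with inl x => f x | inr y => h y end) u.
Proof.
have [fa fD fM] := fh; have [ha hD hM] := hh.
by case=> *; rewrite /= ?fa ?fD ?fM ?ha ?hD ?hM.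
Qed.

Lemma tens_lift_hom : alg_hom tens_lift.
Proof. by have [_ la lD lM] := presented_liftP lift_rel; split. Qed.

Lemma tens_lift_tensor x y : tens_lift (tensor x y) = f x * h y.
Proof.
have [_ _ lM] := tens_lift_hom; have [lg _ _ _] := presented_liftP lift_rel.
by rewrite tensorE lM /tens_lift !lg.
Qed.
End TensorAlgebra.

Section TensorMore.
Context (F : fieldType) (A B : pzAlgType F).
Lemma tensorZl a (x : A) (y : B) : tensor (ascal a * x) y = ascal a * tensor x y.
Proof.
have [la _ lM] := inL_hom A B.
by rewrite !tensorE lM la mulrA.
Qed.
Lemma tensorZr a (x : A) (y : B) : tensor x (ascal a * y) = ascal a * tensor x y.
Proof. by rewrite -tensorZ tensorZl. Qed.
Lemma tensor_suml (I : Type) (r : seq I) (P : pred I) (G : I -> A) (y : B) :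
  tensor (\sum_(i <- r | P i) G i) y = \sum_(i <- r | P i) tensor (G i) y.
Proof.
by apply: (big_morph (fun x => tensor x y)) => [x x'|]; [exact: tensorDl|exact: tensor0l].
Qed.
Lemma tensor_sumr (I : Type) (r : seq I) (P : pred I) (G : I -> B) (x : A) :
  tensor x (\sum_(i <- r | P i) G i) = \sum_(i <- r | P i) tensor x (G i).
Proof. by apply: (big_morph (tensor x)) => [y y'|]; [exact: tensorDr|exact: tensor0r]. Qed.
Lemma tensorBl (x x' : A) (y : B) : tensor (x - x') y = tensor x y - tensor x' y.
Proof. by apply/eqP; rewrite eq_sym subr_eq -tensorDl subrK. Qed.
Lemma tensorBr (x : A) (y y' : B) : tensor x (y - y') = tensor x y - tensor x y'.
Proof. by apply/eqP; rewrite eq_sym subr_eq -tensorDr subrK. Qed.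
End TensorMore.

Section Env.
Context (F : fieldType) (g : lieAlgType F).
Implicit Types x y : g.

Lemma enviZD a x y : envi (a *: x + y) = ascal a * envi x + envi y.
Proof.
rewrite /envi /GRing.add /GRing.mul /= pmul_tcl padd_tcl; apply/tcl_eq/teq_rel.
exact: env_lin.
Qed.

Lemma envi0 : envi (0 : g) = 0.
Proof.
have := enviZD (-1) 0 (0 : g).
by rewrite scaler0 addr0 -{3}[envi 0]mul1r -ascal1 -mulrDl -ascalD addNr ascal0 mul0r.
Qed.

Lemma envi_lie x y : envi (lie x y) = envi x * envi y - envi y * envi x.
Proof.
rewrite /envi /GRing.add /GRing.opp /GRing.mul /= !pmul_tcl popp_tcl padd_tcl.
by apply/tcl_eq/teq_rel; exact: env_lie.
Qed.

Lemma envi_lincomb (I : Type) (r : seq I) (c : I -> F) (v : I -> g) :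
  envi (\sum_(i <- r) c i *: v i) = \sum_(i <- r) ascal (c i) * envi (v i).
Proof. by elim/big_rec2: _ => [|i x y _ <-]; [exact: envi0|rewrite enviZD]. Qed.
End Env.

Section MatrixAlgebra.
Context (F : fieldType) (A : pzAlgType F) (N : nat).
Let sc (a : F) : 'M[A]_N := (ascal a)%:M.
Fact mx_ascalD a c : sc (a + c) = sc a + sc c.
Proof. by rewrite /sc ascalD raddfD. Qed.
Fact mx_ascalM a c : sc (a * c) = sc a * sc c.
Proof. by rewrite /sc ascalM [RHS]mul_scalar_mx scale_scalar_mx. Qed.
Fact mx_ascal1 : sc 1 = 1.
Proof. by rewrite /sc ascal1. Qed.
Fact mx_ascalC a x : sc a * x = x * sc a.
Proof.
apply/matrixP => i j; rewrite [LHS]mxE [RHS]mxE.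
rewrite (bigD1 i) //= big1 ?addr0 => [|k ki]; last first.
  by rewrite mxE eq_sym (negPf ki) mulr0n mul0r.
rewrite (bigD1 j) //= big1 ?addr0 => [|k kj]; last by rewrite mxE (negPf kj) mulr0n mulr0.
by rewrite !mxE !eqxx !mulr1n ascalC.
Qed.
HB.instance Definition _ := PzRing_isPzAlgebra.Build F 'M[A]_N
  mx_ascalD mx_ascalM mx_ascal1 mx_ascalC.

Lemma scalar_mx_hom : alg_hom (fun a : A => a%:M : 'M[A]_N).
Proof.
split=> [a|x y|x y] //; first by rewrite raddfD.
by rewrite [RHS]mul_scalar_mx scale_scalar_mx.
Qed.

(** The subalgebra of matrices over F inside the matrices over A; it commutes with the
    scalar matrices over A, so that both together carry a tensor product. *)
Definition const_mxF (M : 'M[F]_N) : 'M[A]_N := map_mx ascal M.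

Lemma scalar_mulE (a : A) (M : 'M[A]_N) i j : (a%:M * M) i j = a * M i j.
Proof.
rewrite [LHS]mxE (bigD1 i) //= big1 ?addr0 => [|k ki].
  by rewrite mxE eqxx mulr1n.
by rewrite mxE eq_sym (negPf ki) mulr0n mul0r.
Qed.

Lemma mul_scalarE (a : A) (M : 'M[A]_N) i j : (M * a%:M) i j = M i j * a.
Proof.
rewrite [LHS]mxE (bigD1 j) //= big1 ?addr0 => [|k kj].
  by rewrite mxE eqxx mulr1n.
by rewrite mxE (negPf kj) mulr0n mulr0.
Qed.

Lemma const_mxF_comm (a : A) M : a%:M * const_mxF M = const_mxF M * a%:M.
Proof.
by apply/matrixP => i j; rewrite scalar_mulE mul_scalarE mxE ascalC.
Qed.

Lemma scalar_central (a : A) : (forall x, a * x = x * a) ->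
  forall M : 'M[A]_N, a%:M * M = M * a%:M.
Proof. by move=> ac M; apply/matrixP => i j; rewrite scalar_mulE mul_scalarE. Qed.
End MatrixAlgebra.

Lemma const_mxF_hom (F : fieldType) (A : pzAlgType F) N : alg_hom (@const_mxF F A N).
Proof.
have asum (I : finType) (G : I -> F) : ascal (\sum_i G i) = \sum_i ascal (G i) :> A.
  by apply: (big_morph _ (@ascalD F A) (ascal0 A)).
split=> [a|x y|x y]; apply/matrixP => i j; rewrite !mxE //.
- by case: (i == j); rewrite ?mulr1n ?mulr0n ?ascal0.
- by rewrite ascalD.
- by rewrite asum; apply: eq_bigr => k _; rewrite !mxE ascalM.
Qed.

Section AdjointRep.
Context (F : fieldType) (g : lieAlgType F).
Notation N := (\dim {:g}).

Definition env_ad : env g -> 'M[F]_N := presented_lift (@ad F g).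

Let ad_rel t u : @env_rel F g t u -> teval (@ad F g) t = teval (@ad F g) u.
Proof.
case=> [a x y|x y] /=; last by rewrite ad_lie.
by rewrite ad_linear; congr (_ + _); rewrite -mul_scalar_mx.
Qed.

Lemma env_ad_hom : alg_hom env_ad.
Proof. by have [_ la lD lM] := presented_liftP ad_rel; split. Qed.

Lemma env_ad_envi x : env_ad (envi x) = ad x.
Proof. by have [lg _ _ _] := presented_liftP ad_rel; exact: lg. Qed.

(** Adds one tensor factor U(g) to a representation, through the adjoint
    representation: the new factor acts by matrices over F, the old ones by scalar
    matrices. *)
Definition slot (X T : pzAlgType F) (f : X -> T) : tens X (env g) -> 'M[T]_N :=
  tens_lift (fun x => (f x)%:M) (fun y => const_mxF T (env_ad y)).

Lemma comp_hom (X Y Z : pzAlgType F) (f : X -> Y) (h : Y -> Z) :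
  alg_hom f -> alg_hom h -> alg_hom (fun x => h (f x)).
Proof.
by move=> [fa fD fM] [ha hD hM]; split=> [a|x y|x y]; rewrite ?fa ?fD ?fM ?ha ?hD ?hM.
Qed.

Section Slot.
Context (X T : pzAlgType F) (f : X -> T) (fh : alg_hom f).
Let lh := comp_hom fh (scalar_mx_hom T N).
Let rh := comp_hom env_ad_hom (const_mxF_hom T N).
Let lrC x y := const_mxF_comm (f x) (env_ad y).

Lemma slot_hom : alg_hom (slot f).
Proof. exact: tens_lift_hom lh rh lrC. Qed.

Lemma slot_tensor x v : slot f (tensor x (envi v)) = (f x)%:M * const_mxF T (ad v).
Proof. by rewrite /slot (tens_lift_tensor lh rh lrC) env_ad_envi. Qed.
End Slot.

(** The trace of the product with ad v, which extracts the component along v of the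
    last factor added by [slot]. *)
Definition trace_ad (T : pzAlgType F) (v : g) (M : 'M[T]_N) : T :=
  \sum_i \sum_j M i j * ascal (ad v j i).

(** The traces of products of adjoint matrices are values of the Killing form. *)
Lemma trace_adE (T : pzAlgType F) v (y w : T) x :
  trace_ad v (y%:M * const_mxF T (ad x) * w%:M) = ascal (killing x v) * (y * w).
Proof.
rewrite killing_tr /mxtrace.
have asum (I : finType) (G : I -> F) : ascal (\sum_i G i) = \sum_i ascal (G i) :> T.
  by apply: (big_morph _ (@ascalD F T) (ascal0 T)).
rewrite asum mulr_suml; apply: eq_bigr => i _; rewrite mxE asum mulr_suml.
apply: eq_bigr => j _; rewrite mul_scalarE scalar_mulE mxE.
by rewrite [ad x i j * _]mulrC ascalM -(ascalC (ad v j i)) -(ascalC (ad x i j) y) !mulrA.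
Qed.

Lemma trace_adD (T : pzAlgType F) v : {morph @trace_ad T v : M M' / M + M'}.
Proof.
move=> M M'; rewrite -big_split; apply: eq_bigr => i _; rewrite -big_split.
by apply: eq_bigr => j _; rewrite mxE mulrDl.
Qed.

Lemma trace_ad0 (T : pzAlgType F) v : @trace_ad T v 0 = 0.
Proof. by rewrite /trace_ad big1 // => i _; rewrite big1 // => j _; rewrite mxE mul0r. Qed.

Context (D : pzAlgType F) (DC : forall x y : D, x * y = y * x).

Notation T1 := 'M[D]_N.
Notation T2 := 'M[T1]_N.
Notation T3 := 'M[T2]_N.
Notation X3 := (tens (tens (env g) (env g)) (env g)).

Let f1 (x : env g) : T1 := const_mxF D (env_ad x).
Let f2 := slot f1.
Let f3 : X3 -> T3 := slot f2.
Let scal3 (u : D) : T3 := u%:M%:M%:M.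

Let f1h : alg_hom f1 := comp_hom env_ad_hom (const_mxF_hom D N).
Let f2h : alg_hom f2 := slot_hom f1h.
Let f3h : alg_hom f3 := slot_hom f2h.
Let scal3h : alg_hom scal3 := comp_hom (comp_hom (scalar_mx_hom D N) (scalar_mx_hom T1 N))
  (scalar_mx_hom T2 N).
Let f3scal x u : f3 x * scal3 u = scal3 u * f3 x.
Proof. by apply/esym; do 3?[apply: scalar_central => ?]; exact: DC. Qed.

(** Three applications of [slot]; the commutative algebra D is carried along as
    scalar matrices, which are central. *)
Definition adjoint3 : tens X3 D -> T3 := tens_lift f3 scal3.

Lemma adjoint3_hom : alg_hom adjoint3.
Proof. exact: tens_lift_hom f3h scal3h f3scal. Qed.

Lemma adjoint3_tensor x y z u :
  adjoint3 (tensor (tensor (tensor (envi x) (envi y)) (envi z)) u) =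
  (((const_mxF D (ad x))%:M * const_mxF T1 (ad y))%:M * const_mxF T2 (ad z)) * scal3 u.
Proof.
rewrite /adjoint3 (tens_lift_tensor f3h scal3h f3scal) /f3 (slot_tensor f2h).
by rewrite /f2 (slot_tensor f1h) /f1 env_ad_envi.
Qed.

Definition trace3 (x y z : g) (M : T3) : D := trace_ad x (trace_ad y (trace_ad z M)).

Lemma trace3_tensor x y z x' y' z' u :
  trace3 x' y' z' (adjoint3 (tensor (tensor (tensor (envi x) (envi y)) (envi z)) u)) =
  ascal (killing z z') * (ascal (killing y y') * (ascal (killing x x') * u)).
Proof.
have tr_ascal (T : pzAlgType F) v a (M : 'M[T]_N) :
    trace_ad v (ascal a * M) = ascal a * trace_ad v M.
  rewrite /trace_ad mulr_sumr; apply: eq_bigr => i _; rewrite mulr_sumr; apply: eq_bigr => j _.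
  by rewrite scalar_mulE mulrA.
rewrite adjoint3_tensor /trace3 /scal3 trace_adE !tr_ascal; congr (_ * _).
rewrite trace_adE tr_ascal; congr (_ * _).
by rewrite -[const_mxF D (ad x)]mul1r trace_adE mul1r.
Qed.
End AdjointRep.

(** * Commutators of elements placed in two of three tensor slots *)

Section Commutator.
Context (R : pzRingType).
Lemma commutator_suml (I : Type) (r : seq I) (P : pred I) (G : I -> R) y :
  commutator (\sum_(i <- r | P i) G i) y = \sum_(i <- r | P i) commutator (G i) y.
Proof. by rewrite /commutator mulr_suml mulr_sumr sumrB. Qed.
Lemma commutator_sumr (I : Type) (r : seq I) (P : pred I) (G : I -> R) y :
  commutator y (\sum_(i <- r | P i) G i) = \sum_(i <- r | P i) commutator y (G i).
Proof. by rewrite /commutator mulr_suml mulr_sumr sumrB. Qed.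
Lemma commutator_sum2 (I J K L : finType) (X : I -> J -> R) (Y : K -> L -> R) :
  commutator (\sum_i \sum_j X i j) (\sum_k \sum_l Y k l) =
  \sum_i \sum_j \sum_k \sum_l commutator (X i j) (Y k l).
Proof.
rewrite commutator_suml; apply: eq_bigr => i _; rewrite commutator_suml; apply: eq_bigr => j _.
by rewrite commutator_sumr; apply: eq_bigr => k _; rewrite commutator_sumr.
Qed.
End Commutator.

Lemma dual_pick (U V : zmodType) (phi : U -> V) (phiD : {morph phi : x y / x + y})
    (phi0 : phi 0 = 0) (I J K : finType) (X : I -> J -> K -> U) m i j (c : V) :
  (forall p q l, phi (X p q l) = if (p == m) && (q == i) && (l == j) then c else 0) ->
  \sum_p \sum_q \sum_l X p q l = 0 -> c = 0.
Proof.
move=> h /(congr1 phi); rewrite phi0 => <-.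
have phiS := big_morph phi phiD phi0.
rewrite phiS (bigD1 m) //= phiS (bigD1 i) //= phiS (bigD1 j) //=.
rewrite h !eqxx /= !big1 ?addr0 // => [p pm|q qi|l lj].
- by rewrite phiS big1 // => q _; rewrite phiS big1 // => l _; rewrite h (negPf pm).
- by rewrite phiS big1 // => l _; rewrite h (negPf qi) andbF.
- by rewrite h (negPf lj) andbF.
Qed.

Section TripleTensor.
Context (F : fieldType) (g : lieAlgType F).
Context (d : nat) (b : d.-tuple g) (bon : orthonormal_basis b).
Context (D : pzAlgType F) (DC : forall u v : D, u * v = v * u).
Notation U4 := (tens (tens (tens (env g) (env g)) (env g)) D).
Notation e i := (envi b`_i).
Implicit Types (x y z : env g) (u v : D).

(** The commutative algebra D stands for A_3: keeping it abstract separates the bracket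
    computations in U(g) from the products of nested series. *)
Definition tens4 x y z u : U4 := tensor (tensor (tensor x y) z) u.
Notation t4 := tens4.

Lemma tens4M x y z u x' y' z' u' :
  t4 x y z u * t4 x' y' z' u' = t4 (x * x') (y * y') (z * z') (u * u').
Proof. by rewrite /tens4 !tensorM. Qed.

Lemma tens4_sum (I : Type) (r : seq I) (P : pred I) (G : I -> D) x y z :
  t4 x y z (\sum_(i <- r | P i) G i) = \sum_(i <- r | P i) t4 x y z (G i).
Proof. exact: tensor_sumr. Qed.

Lemma tens4D x y z u v : t4 x y z (u + v) = t4 x y z u + t4 x y z v.
Proof. exact: tensorDr. Qed.

Lemma tens4_0 x y z : t4 x y z 0 = 0.
Proof. exact: tensor0r. Qed.

Lemma envi_coord (v : g) : envi v = \sum_(m < d) ascal (coord b m v) * e m.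
Proof. by rewrite [v in LHS](coord_exp bon) envi_lincomb. Qed.

Lemma tens4_coord1 (v : g) y z u :
  t4 (envi v) y z u = \sum_(m < d) t4 (e m) y z (ascal (coord b m v) * u).
Proof.
rewrite /tens4 envi_coord !tensor_suml; apply: eq_bigr => m _.
by rewrite !tensorZl tensorZr.
Qed.

Lemma tens4_coord2 (v : g) x z u :
  t4 x (envi v) z u = \sum_(m < d) t4 x (e m) z (ascal (coord b m v) * u).
Proof.
rewrite /tens4 envi_coord tensor_sumr !tensor_suml; apply: eq_bigr => m _.
by rewrite tensorZr !tensorZl tensorZr.
Qed.

Lemma tens4_coord3 (v : g) x y u :
  t4 x y (envi v) u = \sum_(m < d) t4 x y (e m) (ascal (coord b m v) * u).
Proof.
rewrite /tens4 envi_coord tensor_sumr tensor_suml; apply: eq_bigr => m _.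
by rewrite tensorZr !tensorZl tensorZr.
Qed.

Lemma commutator_12_13 (p q i j : 'I_d) u v :
  commutator (t4 (e p) (e i) 1 u) (t4 (e q) 1 (e j) v) =
  \sum_(m < d) t4 (e m) (e i) (e j) (ascal (struct_const b p q m) * (u * v)).
Proof.
rewrite -tens4_coord1 envi_lie /commutator !tens4M !mul1r !mulr1 [v * u]DC.
by rewrite /tens4 !tensorBl.
Qed.

Lemma commutator_12_23 (p q i j : 'I_d) u v :
  commutator (t4 (e i) (e p) 1 u) (t4 1 (e q) (e j) v) =
  \sum_(m < d) t4 (e i) (e m) (e j) (ascal (struct_const b p q m) * (u * v)).
Proof.
rewrite -tens4_coord2 envi_lie /commutator !tens4M !mul1r !mulr1 [v * u]DC.
by rewrite /tens4 tensorBr !tensorBl.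
Qed.

Lemma commutator_13_23 (p q i j : 'I_d) u v :
  commutator (t4 (e i) 1 (e p) u) (t4 1 (e j) (e q) v) =
  \sum_(m < d) t4 (e i) (e j) (e m) (ascal (struct_const b p q m) * (u * v)).
Proof.
rewrite -tens4_coord3 envi_lie /commutator !tens4M !mul1r !mulr1 [v * u]DC.
by rewrite /tens4 tensorBr tensorBl.
Qed.

(** Taking traces against ad b_m, ad b_i and ad b_j in the three adjoint factors
    recovers C m i j, because the basis is orthonormal for the Killing form. *)
Lemma tens4_basis_free (C : 'I_d -> 'I_d -> 'I_d -> D) :
  \sum_(m < d) \sum_(i < d) \sum_(j < d) t4 (e m) (e i) (e j) (C m i j) = 0 ->
  forall m i j, C m i j = 0.
Proof.
move=> C0 m i j.
have kd (p q : 'I_d) : ascal (killing b`_p b`_q) = if p == q then 1 else 0 :> D.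
  by rewrite (proj2 bon); case: (p == q); rewrite ?ascal1 ?ascal0.
pose phi (X : U4) := trace3 b`_m b`_i b`_j (adjoint3 (D := D) X).
have phiD : {morph phi : X Y / X + Y}.
  by move=> X Y; have [_ hD _] := adjoint3_hom g DC; rewrite /phi hD /trace3 !trace_adD.
have phi0 : phi 0 = 0 by rewrite /phi (alg_hom0 (adjoint3_hom g DC)) /trace3 !trace_ad0.
apply: (dual_pick (m := m) (i := i) (j := j) phiD phi0 _ C0) => p q l.
rewrite /phi /tens4 (trace3_tensor DC) !kd.
case: eqP => [->|_]; case: eqP => [->|_]; case: eqP => [->|_];
by rewrite /= ?mul0r ?mulr0 ?mul1r.
Qed.

Context (u12 u13 u23 w23 : 'I_d -> 'I_d -> D).

(** The coefficient of b_m (x) b_i (x) b_j, by the structure constants in the slot shared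
    by the two factors of each commutator. *)
Definition triple_coef (m i j : 'I_d) : D :=
  \sum_p \sum_q ascal (struct_const b p q m) * (u12 p i * u13 q j)
  + \sum_p \sum_q ascal (struct_const b p q i) * (u12 m p * u23 q j)
  + \sum_p \sum_q ascal (struct_const b p q j) * (u13 m p * w23 i q).

Definition place12 (u : 'I_d -> 'I_d -> D) : U4 :=
  \sum_(i < d) \sum_(j < d) t4 (e j) (e i) 1 (u j i).
Definition place13 (u : 'I_d -> 'I_d -> D) : U4 :=
  \sum_(i < d) \sum_(j < d) t4 (e j) 1 (e i) (u j i).
Definition place23 (u : 'I_d -> 'I_d -> D) : U4 :=
  \sum_(i < d) \sum_(j < d) t4 1 (e j) (e i) (u j i).

Lemma triple_coefE :
  commutator (place12 u12) (place13 u13) + commutator (place12 u12) (place23 u23)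
  + commutator (place13 u13) (place23 w23) =
  \sum_(m < d) \sum_(i < d) \sum_(j < d) t4 (e m) (e i) (e j) (triple_coef m i j).
Proof.
have -> : commutator (place12 u12) (place13 u13) + commutator (place12 u12) (place23 u23)
  + commutator (place13 u13) (place23 w23) =
    \sum_(m < d) \sum_(i < d) \sum_(j < d) \sum_p \sum_q
      t4 (e m) (e i) (e j) (ascal (struct_const b p q m) * (u12 p i * u13 q j))
  + \sum_(m < d) \sum_(i < d) \sum_(j < d) \sum_p \sum_q
      t4 (e m) (e i) (e j) (ascal (struct_const b p q i) * (u12 m p * u23 q j))
  + \sum_(m < d) \sum_(i < d) \sum_(j < d) \sum_p \sum_q
      t4 (e m) (e i) (e j) (ascal (struct_const b p q j) * (u13 m p * w23 i q)).
  rewrite /place12 /place13 /place23 !commutator_sum2; congr (_ + _ + _).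
  - (* the sums come in the order i, p, j, q, m *)
    under eq_bigr do under eq_bigr do under eq_bigr do under eq_bigr do
      rewrite commutator_12_13.
    under eq_bigr do under eq_bigr do under eq_bigr do rewrite exchange_big.
    under eq_bigr do under eq_bigr do rewrite exchange_big.
    under eq_bigr do rewrite exchange_big.
    rewrite exchange_big; apply: eq_bigr => m _; apply: eq_bigr => i _ /=.
    by rewrite exchange_big.
  - (* the sums come in the order p, m, j, q, i *)
    under eq_bigr do under eq_bigr do under eq_bigr do under eq_bigr do
      rewrite commutator_12_23.
    rewrite exchange_big; apply: eq_bigr => m _ /=.
    under eq_bigr do under eq_bigr do rewrite exchange_big.
    under eq_bigr do rewrite exchange_big.
    rewrite exchange_big; apply: eq_bigr => i _ /=.
    by rewrite exchange_big.
  - (* the sums come in the order p, m, q, i, j *)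
    under eq_bigr do under eq_bigr do under eq_bigr do under eq_bigr do
      rewrite commutator_13_23.
    rewrite exchange_big; apply: eq_bigr => m _ /=.
    under eq_bigr do rewrite exchange_big.
    rewrite exchange_big; apply: eq_bigr => i _ /=.
    under eq_bigr do rewrite exchange_big.
    by rewrite exchange_big.
rewrite -!big_split; apply: eq_bigr => m _; rewrite -!big_split; apply: eq_bigr => i _.
rewrite -!big_split; apply: eq_bigr => j _ /=; rewrite !tens4D; congr (_ + _ + _).
all: by rewrite tens4_sum; apply: eq_bigr => p _; rewrite tens4_sum.
Qed.

Lemma triple_eq0 :
  commutator (place12 u12) (place13 u13) + commutator (place12 u12) (place23 u23)
  + commutator (place13 u13) (place23 w23) = 0 <-> forall m i j, triple_coef m i j = 0.
Proof.
rewrite triple_coefE; split; first exact: tens4_basis_free.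
move=> h; rewrite big1 // => m _; rewrite big1 // => i _; rewrite big1 // => j _.
by rewrite h tens4_0.
Qed.
End TripleTensor.

(** * The coefficients of GCYB *)

Section TripleDiag.
Context (F : fieldType) (n : nat) (g : lieAlgType F) (d : nat) (b : d.-tuple g).
Context (R : pzAlgType F) (x12 : 'I_d -> 'I_d -> R) (c13 c23 w23 : 'I_d -> 'I_d -> nat -> R).

(** The coefficient of x_3^k in [triple_coef] when the elements placed in 13 and 23 are
    power series in x_3 and those placed in 12 do not involve x_3. *)
Definition triple_diag (m i j : 'I_d) (k : nat) : R :=
  \sum_p \sum_q ascal (struct_const b p q m) * (x12 p i * c13 q j k)
  + \sum_p \sum_q ascal (struct_const b p q i) * (x12 m p * c23 q j k)
  + \sum_p \sum_q ascal (struct_const b p q j) * \sum_(a < k.+1) c13 m p a * w23 i q (k - a)%N.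

Lemma triple_coef_diag m i j :
  triple_coef b (fun p i => adj_const n (x12 p i)) (fun p i => diag n (c13 p i))
    (fun p i => diag n (c23 p i)) (fun p i => diag n (w23 p i)) m i j =
  diag n (triple_diag m i j).
Proof.
rewrite /triple_coef /triple_diag -!diagD -!ascal_sum_diag; congr (_ + _ + _).
all: apply: eq_bigr => p _; apply: eq_bigr => q _; congr (_ * _).
- exact: adj_const_mul.
- exact: adj_const_mul.
- exact: diag_mul.
Qed.
End TripleDiag.

Section Slice.
Context (F : fieldType) (n : nat) (g : lieAlgType F).
Context (d : nat) (b : d.-tuple g) (bon : orthonormal_basis b).
Notation A1 := (adj n F).
Notation A2 := (adj n A1).
Notation A3 := (adj n A2).
Notation co := (@lcoord F n d g b F).
Implicit Types (r : series n d g).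

Lemma adj_coef_0 (x : int + 'I_n) : adj_coef x (0 : A1) = 0.
Proof. by apply: (@addrI _ (adj_coef x 0)); rewrite -adj_coefD !addr0. Qed.

Notation lam x := (adj_map (n := n) (adj_coef_0 x)).

Lemma lamD x : {morph lam x : U W / U + W : A2 >-> U + W : A1}.
Proof. by apply: adj_mapD => U W; exact: adj_coefD. Qed.

Lemma lam0 x : lam x (0 : A2) = 0.
Proof. by apply: (@addrI _ (lam x 0)); rewrite -lamD !addr0. Qed.

Lemma lam_sum x (I : Type) (r : seq I) (P : pred I) (G : I -> A2) :
  lam x (\sum_(i <- r | P i) G i) = \sum_(i <- r | P i) lam x (G i).
Proof. exact: (big_morph _ (lamD x) (lam0 x)). Qed.

Lemma lam_ascal x a (U : A2) : lam x (ascal a * U) = ascal a * lam x U.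
Proof.
case: U => f p; congr pair.
  apply: laurentP => k; rewrite [RHS]lmul_mono0l /= -[ascal a in RHS]/a -adj_coef_ascal.
  by congr (adj_coef x _); exact: lmul_mono0l.
apply: truncP => k; rewrite [RHS]tconst_mul !tmapE /= -[ascal a in RHS]/a -adj_coef_ascal.
by congr (adj_coef x _); exact: tconst_mul.
Qed.

(** A functional on the coefficients in A_1 is F-linear, so it commutes with
    multiplication by a series whose coefficients are scalars. *)
Lemma lam_mul x (U : A2) j (v : adj n g) :
  lam x (U * lcoord b A1 j v) = lam x U * co j v.
Proof.
have op0l z : 0 * coef_in b A1 j z = 0 by rewrite mul0r.
have op0r y : y * coef_in b A1 j 0 = 0 by rewrite coef_in0 mulr0.
rewrite /lcoord (mul_adj_map _ op0l op0r).
rewrite (@adj_conv_coord n A1 g A1 F _ _ _ (adj_coef x) _ (adj_coefD x) 'I_1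
  (fun _ => adj_coef x) (fun _ => coef_in b F j)
  (fun _ => adj_coef_0 x) (fun _ => coef_in0 b F j)).
  by rewrite big_ord1.
by move=> y z; rewrite big_ord1 /coef_in -ascalC adj_coef_ascal mulrC.
Qed.

Lemma lam_sep (U : A2) : (forall x, lam x U = 0) -> U = 0.
Proof.
move=> h; have sep (y : A1) : (forall x, adj_coef x y = 0) -> y = 0.
  move=> hy; apply: injective_projections.
    by apply: laurentP => k; exact: (hy (inl k)).
  by apply: truncP => k; rewrite -[LHS]/(adj_coef (inr k) y) hy /tcoef ffunE.
apply: injective_projections.
  apply: laurentP => k; apply: sep => x.
  exact: (congr1 (fun w : A1 => w.1 k) (h x)).
apply: truncP => k; transitivity (0 : A1); last by rewrite /tcoef ffunE.
apply: sep => x; have := congr1 (fun w : A1 => tcoef w.2 k) (h x).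
by rewrite tmapE => ->; rewrite /tcoef ffunE.
Qed.

Lemma lcoord_dual_diag r f p : co p (dual_diag b r f) = diag n (fun l => f (r l p)).
Proof.
by rewrite lcoord_diag; congr (diag n _); apply/funext => l; rewrite (coord_comb bon).
Qed.

(** A_3 as a single named algebra, so that all statements below refer to one and the
    same algebra structure on nested series. *)
Definition D3 : pzAlgType F := A3.

Definition u12 r (j i : 'I_d) : D3 := adj_const n (diag n (fun k => co j (r k i))).
Definition u13 r (j i : 'I_d) : D3 := diag n (fun k => adj_const n (co j (r k i))).
Definition u23 r (j i : 'I_d) : D3 := diag n (fun k => lcoord b A1 j (r k i)).

Context (s : nat -> F).

Definition slice r (m i j : 'I_d) (k : nat) : A2 :=
  triple_diag b (fun p i => diag n (fun l => co p (r l i)))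
    (fun p i k => adj_const n (co p (r k i))) (fun p i k => lcoord b A1 p (r k i))
    (fun p i k => lcoord b A1 p (ns_bar b s r k i)) m i j k.

Lemma triple_coef_slice r m i j :
  triple_coef (D := D3) b (u12 r) (u13 r) (u23 r) (u23 (ns_bar b s r)) m i j =
  diag n (slice r m i j).
Proof. exact: triple_coef_diag. Qed.

(** Applying a coefficient functional of A_1 in the variable x_1 turns the coefficient of
    x_3^k in GCYB(r) into the defect; the series in x_2 that remain are the
    coordinates of elements of L. *)
Lemma lam_slice x r m i j k :
  lam x (slice r m i j k) = co i (defect b s r (fun u => adj_coef x (co m u)) k j).
Proof.
rewrite /slice /triple_diag /defect !lamD !lcoordD; congr (_ + _ + _).
- under eq_bigr do under eq_bigr do rewrite mul_adj_const.
  rewrite lcoord_dual_diag ascal_sum_diag adj_map_diag; congr (diag n _); apply/funext => l.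
  by rewrite (lcoord_lie bon).
- rewrite lam_sum (lcoord_lie bon); apply: eq_bigr => p _.
  rewrite lam_sum; apply: eq_bigr => q _.
  by rewrite lam_ascal lam_mul adj_map_diag lcoord_dual_diag.
- rewrite lam_sum lcoord_sum.
  under [RHS]eq_bigr do rewrite lcoord_sum.
  rewrite [RHS]exchange_big; apply: eq_bigr => p _ /=; rewrite lam_sum.
  under [RHS]eq_bigr do rewrite lcoord_sum.
  rewrite [RHS]exchange_big; apply: eq_bigr => q _ /=; rewrite lam_ascal lam_sum mulr_sumr.
  apply: eq_bigr => a _; rewrite lcoordZ lam_mul adj_map_diag.
  have -> : diag n (fun l => adj_coef x (if l == 0%N then co m (r a p) else 0)) =
      ascal (adj_coef x (co m (r a p))).
    rewrite ascal_adj_const; congr (diag n _); apply/funext => l.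
    by case: ifP => // _; rewrite adj_coef_0.
  by rewrite mulrA -ascalM mulrC.
Qed.

Lemma triple_defect r :
  (forall m i j,
    triple_coef (D := D3) b (u12 r) (u13 r) (u23 r) (u23 (ns_bar b s r)) m i j = 0) <->
  (forall x m k j, defect b s r (fun u => adj_coef x (co m u)) k j = 0).
Proof.
split=> [h x m k j|h m i j].
  apply: (lcoord_inj bon) => i; rewrite -lam_slice lcoord0.
  have sl0 := proj1 (diag_eq0 _ _) (etrans (esym (triple_coef_slice r m i j)) (h m i j)).
  by rewrite sl0 lam0.
apply: (etrans (triple_coef_slice r m i j)); apply: (proj2 (diag_eq0 _ _)) => k.
by apply: lam_sep => x; rewrite lam_slice h lcoord0.
Qed.

Lemma D3_mulC (u v : D3) : u * v = v * u.
Proof. by do 3?[apply: adj_mulC => ? ?]; exact: mulrC. Qed.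

Lemma gcyb_triple r : gcyb b s r =
  commutator (place12 b (u12 r)) (place13 b (u13 r))
  + commutator (place12 b (u12 r)) (place23 b (u23 r))
  + commutator (place13 b (u13 r)) (place23 b (u23 (ns_bar b s r))).
Proof.
cbv delta [gcyb r12 r13 r23 place12 place13 place23 tens4 tensor4 u12 u13 u23 U3A3 D3] beta.
reflexivity.
Qed.

Lemma gcyb_defect r : gcyb b s r = 0 <->
  (forall x m k j, defect b s r (fun u => adj_coef x (co m u)) k j = 0).
Proof.
apply: (iff_trans _ (triple_defect r)).
apply: (iff_trans _ (triple_eq0 (D := D3) bon D3_mulC _ _ _ _)).
by rewrite gcyb_triple.
Qed.
End Slice.

(** * The correspondence *)

Theorem corollary2 (F : closedFieldType) (charF0 : [pchar F] =i pred0)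
  (g : lieAlgType F) (g_simple : simple_lie g)
  (d : nat) (b : d.-tuple g) (b_orthonormal : orthonormal_basis b)
  (n : nat) (alpha : int -> F)
  (s : nat -> F) (s_def : lser s * (lmono n%:Z 1 * alpha_ser n alpha) = 1) :
  set_bij
    [set r : series n d g | ns_type b s r /\ skew_symmetric b s r]
    [set V : set (adj n g) | [/\ is_subspace V, lagrangian alpha V
                               & complementary (@diag_set F n g) V]]
    (@wspan F n d g) /\
  set_bij
    [set r : series n d g | ns_type b s r /\ gcyb b s r = 0]
    [set V : set (adj n g) | is_subalgebra V /\ complementary (@diag_set F n g) V]
    (@wspan F n d g).
Proof.
have skewP (r : series n d g) (hr : ns_type b s r) := skew_lagrangian b_orthonormal s_def hr.
have gcybP (r : series n d g) (hr : ns_type b s r) : gcyb b s r = 0 <-> is_subalgebra (wspan r).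
  apply: (iff_trans (gcyb_defect b_orthonormal s r)).
  exact: iff_sym (subalgebra_defect b_orthonormal s_def hr).
have compl (r : series n d g) (hr : ns_type b s r) := wspan_compl b_orthonormal s_def hr.
have inj P : set_inj [set r : series n d g | ns_type b s r /\ P r] (@wspan F n d g).
  move=> r r' /set_mem[hr _] /set_mem[hr' _].
  exact: (wspan_inj b_orthonormal s_def hr hr').
split; split=> //.
- move=> r [hr sk]; split; [exact: wspan_subspace|exact/skewP|exact: compl].
- move=> V [sV lV cV].
  have [r hr rV] := ns_type_exists b_orthonormal s_def sV cV.
  by exists r => //; split=> //; apply/skewP; rewrite ?rV.
- by move=> r [hr gr]; split; [exact/gcybP|exact: compl].
- move=> V [sV cV].
  have [r hr rV] := ns_type_exists b_orthonormal s_def (proj1 sV) cV.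
  by exists r => //; split=> //; apply/gcybP; rewrite ?rV.
Qed.
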